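(* For every $n\ge 3$, both $$x_n:=a_nb_n,\qquad y_n:=b_n$$ have infinite order, and $$a_n=x_ny_n^{-1},\qquad b_n=y_n.$$ Hence $$\mathrm{SL}_n(\mathbb Z)\cong\bigl\langle x,y\,\big|\,\mathcal R_n(xy^{-1},y)\bigr\rangle,$$ where $\mathcal R_n(xy^{-1},y)$ is obtained from the set of relations $\mathcal R_n(a,b)$ by substituting $a=xy^{-1}$ and $b=y$.
   Context: $E_{i,j}$ is the standard $n\times n$ matrix unit, $[x,y]=x^{-1}y^{-1}xy$, and a relation $U=V$ means the relator $UV^{-1}$. Put $\varepsilon_n=(-1)^{n-1}$ and $$a_n=\sum_{i=1}^{n-1}E_{i,i+1}+\varepsilon_nE_{n,1},\qquad b_n=I_n+E_{2,1},$$ elements of $\mathrm{SL}_n(\mathbb Z)$; the generators $x,y$ of the presentation correspond to $x_n,y_n$. The words $\tau_{ij}=\tau_{i,j}=\tau_{ij}(a,b)$ in the free group on $a,b$ ($1\le i\ne j\le n$) are defined as follows. Step 1: $\tau_{r+1,r}:=a^{-(r-1)}ba^{r-1}$ for $1\le r\le n-1$, and $\tau_{1n}:=\bigl(a^{-(n-1)}ba^{n-1}\bigr)^{\varepsilon_n}$. Step 2: for $d=2,\dots,n-1$ successively and all $i,j$ with $i-j=d$, $\tau_{ij}:=[\tau_{i,j+1},\tau_{j+1,j}]$. Step 3: for $2\le i\le n-1$, $\tau_{in}:=[\tau_{i1},\tau_{1n}]$. Step 4: for $1\le i<j\le n-1$, $\tau_{ij}:=[\tau_{in},\tau_{nj}]$.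 $\mathcal R_n(a,b)$ denotes the following set of relations (indices in $\{1,\dots,n\}$): (1) $[\tau_{i,j},\tau_{k,l}]=1$ for all $i\neq j$, $k\ne l$ with $(i,j)\ne(k,l)$, $i\ne l$, $j\ne k$; (2) $[\tau_{i,j},\tau_{j,k}]=\tau_{i,k}$ for distinct $i,j,k$; (3) $(\tau_{1,2}\tau_{2,1}^{-1}\tau_{1,2})^4=1$; (4) $a=(\tau_{n-1,n}\tau_{n,n-1}^{-1}\tau_{n-1,n})(\tau_{n-2,n-1}\tau_{n-1,n-2}^{-1}\tau_{n-2,n-1})\cdots(\tau_{1,2}\tau_{2,1}^{-1}\tau_{1,2})$. *)

(* Defs.v *)
From HB Require Import structures.
From mathcomp Require Import all_boot all_order all_algebra.
From mathcomp Require Import boolp.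

Set Implicit Arguments.
Unset Strict Implicit.
Unset Printing Implicit Defensive.

Import GRing.Theory.

Local Open Scope quotient_scope.
Local Open Scope group_scope.

Definition infinite_order (G : groupType) (g : G) : Prop :=
  forall k : nat, (0 < k)%N -> g ^+ k <> 1.

(* The free group on X: words in the letters x^{+1} = (x, true) and
   x^{-1} = (x, false), modulo insertion and deletion of inverse pairs. *)
Section FreeGroup.
Variable X : choiceType.

Definition word := seq (X * bool).

Inductive free_eq : word -> word -> Prop :=
| free_refl u : free_eq u u
| free_sym u v : free_eq u v -> free_eq v u
| free_trans u v w : free_eq u v -> free_eq v w -> free_eq u w
| free_cancel u v x e : free_eq (u ++ (x, e) :: (x, ~~ e) :: v) (u ++ v).

Definition free_eqb (u v : word) : bool := `[< free_eq u v >].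

Lemma free_eqb_refl : reflexive free_eqb.
Proof. by move=> u; apply/asboolP; apply: free_refl. Qed.

Lemma free_eqb_sym : symmetric free_eqb.
Proof. by move=> u v; apply/asboolP/asboolP; apply: free_sym. Qed.

Lemma free_eqb_trans : transitive free_eqb.
Proof.
by move=> v u w /asboolP uv /asboolP vw; apply/asboolP; apply: free_trans uv vw.
Qed.

Canonical free_equiv :=
  EquivRel free_eqb free_eqb_refl free_eqb_sym free_eqb_trans.

Definition free_group := {eq_quot free_equiv}.
HB.instance Definition _ := Choice.on free_group.
HB.instance Definition _ := EqQuotient.on free_group.

Definition free_mul (g h : free_group) : free_group := \pi_free_group (repr g ++ repr h).
Definition free_one : free_group := \pi_free_group [::].
Definition inv_word (u : word) : word := rev [seq (l.1, ~~ l.2) | l <- u].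
Definition free_inv (g : free_group) : free_group := \pi_free_group (inv_word (repr g)).
Definition free_gen (x : X) : free_group := \pi_free_group [:: (x, true)].

Lemma free_eqP u v : reflect (free_eq u v) (\pi_free_group u == \pi_free_group v).
Proof. by rewrite eqmodE; apply: asboolP. Qed.

Lemma free_repr u : free_eq (repr (\pi_free_group u)) u.
Proof. by apply/free_eqP; rewrite reprK. Qed.

Lemma free_eq_catl w u v : free_eq u v -> free_eq (w ++ u) (w ++ v).
Proof.
elim=> [t|s t _|s t z _ IH1 _|s t x e]; [exact: free_refl|exact: free_sym| |].
  exact: free_trans IH1.
by rewrite !catA; apply: free_cancel.
Qed.

Lemma free_eq_catr w u v : free_eq u v -> free_eq (u ++ w) (v ++ w).
Proof.
elim=> [t|s t _|s t z _ IH1 _|s t x e]; [exact: free_refl|exact: free_sym| |].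
  exact: free_trans IH1.
by rewrite -!catA; apply: free_cancel.
Qed.

Lemma free_eq_cat u u' v v' :
  free_eq u u' -> free_eq v v' -> free_eq (u ++ v) (u' ++ v').
Proof.
by move=> uu' vv'; apply: (free_trans (free_eq_catr v uu')); apply: free_eq_catl.
Qed.

Lemma inv_word_catK u : free_eq (inv_word u ++ u) [::].
Proof.
elim: u => [|[x e] u IHu]; first exact: free_refl.
rewrite /inv_word /= rev_cons cat_rcons.
by apply: free_trans IHu; have := free_cancel (inv_word u) u x (~~ e); rewrite negbK.
Qed.

Lemma cat_inv_wordK u : free_eq (u ++ inv_word u) [::].
Proof.
elim/last_ind: u => [|u [x e] IHu]; first exact: free_refl.
rewrite /inv_word map_rcons rev_rcons cat_rcons /=.
by apply: free_trans IHu; apply: free_cancel.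
Qed.

Lemma free_mulA : associative free_mul.
Proof.
move=> f g h; apply/eqP/free_eqP.
apply: (free_trans (free_eq_catl _ (free_repr _))).
by rewrite catA; apply: free_eq_catr; apply: free_sym; apply: free_repr.
Qed.

Lemma free_mul1g : left_id free_one free_mul.
Proof.
move=> g; rewrite -[RHS]reprK; apply/eqP/free_eqP.
exact: (free_eq_catr _ (free_repr [::])).
Qed.

Lemma free_mulg1 : right_id free_one free_mul.
Proof.
move=> g; rewrite -[RHS]reprK; apply/eqP/free_eqP.
by rewrite -[X in free_eq _ X]cats0; apply: free_eq_catl; apply: free_repr.
Qed.

Lemma free_mulVg : left_inverse free_one free_inv free_mul.
Proof.
move=> g; apply/eqP/free_eqP.
by apply: free_trans (inv_word_catK _); apply/free_eq_catr/free_repr.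
Qed.

Lemma free_mulgV : right_inverse free_one free_inv free_mul.
Proof.
move=> g; apply/eqP/free_eqP.
by apply: free_trans (cat_inv_wordK _); apply/free_eq_catl/free_repr.
Qed.

HB.instance Definition _ := isGroup.Build free_group
  free_mulA free_mul1g free_mulg1 free_mulVg free_mulgV.

End FreeGroup.

(* The quotient of G by the normal closure of the relators u v^-1, for the
   relations u = v in rel. *)
Section PresentedGroup.
Variables (G : groupType) (rel : G -> G -> Prop).

Inductive normal_closure : G -> Prop :=
| ncl_relator u v : rel u v -> normal_closure (u * v^-1)
| ncl_1 : normal_closure 1
| ncl_mul g h : normal_closure g -> normal_closure h -> normal_closure (g * h)
| ncl_inv g : normal_closure g -> normal_closure g^-1
| ncl_conj g h : normal_closure g -> normal_closure (g ^ h).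

Definition rel_eqb (g h : G) : bool := `[< normal_closure (g * h^-1) >].

Lemma rel_eqb_refl : reflexive rel_eqb.
Proof. by move=> g; apply/asboolP; rewrite mulgV; apply: ncl_1. Qed.

Lemma rel_eqb_sym : symmetric rel_eqb.
Proof. by move=> g h; apply/asboolP/asboolP => /ncl_inv; rewrite invgF. Qed.

Lemma rel_eqb_trans : transitive rel_eqb.
Proof.
move=> h g k /asboolP gh /asboolP hk; apply/asboolP.
by have := ncl_mul gh hk; rewrite mulgA mulgVK.
Qed.

Canonical rel_equiv := EquivRel rel_eqb rel_eqb_refl rel_eqb_sym rel_eqb_trans.

Definition rel_quot := {eq_quot rel_equiv}.
HB.instance Definition _ := Choice.on rel_quot.
HB.instance Definition _ := EqQuotient.on rel_quot.

Definition rq_mul (p q : rel_quot) : rel_quot := \pi_rel_quot (repr p * repr q).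
Definition rq_one : rel_quot := \pi_rel_quot 1.
Definition rq_inv (p : rel_quot) : rel_quot := \pi_rel_quot (repr p)^-1.

Lemma rq_eqP g h : reflect (normal_closure (g * h^-1)) (\pi_rel_quot g == \pi_rel_quot h).
Proof. by rewrite eqmodE; apply: asboolP. Qed.

Lemma rq_repr g : normal_closure (repr (\pi_rel_quot g) * g^-1).
Proof. by apply/rq_eqP; rewrite reprK. Qed.

Lemma rq_piM g h : rq_mul (\pi_rel_quot g) (\pi_rel_quot h) = \pi_rel_quot (g * h).
Proof.
apply/eqP/rq_eqP; have := rq_repr g; have := rq_repr h.
set g' := repr _; set h' := repr _ => /(ncl_conj g^-1) Hh Hg.
by have := ncl_mul Hg Hh; rewrite /conjg invgK invgM !mulgA mulgVK.
Qed.

Lemma rq_piV g : rq_inv (\pi_rel_quot g) = \pi_rel_quot g^-1.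
Proof.
apply/eqP/rq_eqP; have := rq_repr g; set g' := repr _ => /ncl_inv.
by move/(ncl_conj g); rewrite invgF /conjg invgK !mulgA mulVg mul1g.
Qed.

Lemma rq_mulA : associative rq_mul.
Proof.
elim/quotW=> g; elim/quotW=> h; elim/quotW=> k.
by rewrite (rq_piM h k) (rq_piM g h) !rq_piM mulgA.
Qed.

Lemma rq_mul1g : left_id rq_one rq_mul.
Proof. by elim/quotW=> g; rewrite rq_piM mul1g. Qed.

Lemma rq_mulg1 : right_id rq_one rq_mul.
Proof. by elim/quotW=> g; rewrite rq_piM mulg1. Qed.

Lemma rq_mulVg : left_inverse rq_one rq_inv rq_mul.
Proof. by elim/quotW=> g; rewrite rq_piV rq_piM mulVg. Qed.

Lemma rq_mulgV : right_inverse rq_one rq_inv rq_mul.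
Proof. by elim/quotW=> g; rewrite rq_piV rq_piM mulgV. Qed.

HB.instance Definition _ := isGroup.Build rel_quot
  rq_mulA rq_mul1g rq_mulg1 rq_mulVg rq_mulgV.

End PresentedGroup.

Section SpecialLinear.
Local Open Scope ring_scope.
Variables (R : comUnitRingType) (n : nat).

Record SL := MkSL { slval :> 'M[R]_n; _ : \det slval == 1 }.

HB.instance Definition _ := [isSub for slval].
HB.instance Definition _ := [Choice of SL by <:].

Implicit Types A B C : SL.

Lemma sl_det A : \det A = 1.
Proof. by case: A => A /= /eqP. Qed.

Lemma sl_unit A : (A : 'M[R]_n) \in unitmx.
Proof. by rewrite unitmxE sl_det unitr1. Qed.

Fact sl_mul_subproof A B : \det (A *m B) == 1.
Proof. by rewrite det_mulmx !sl_det mulr1. Qed.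
Fact sl_one_subproof : \det (1%:M : 'M[R]_n) == 1.
Proof. by rewrite det1. Qed.
Fact sl_inv_subproof A : \det (invmx A) == 1.
Proof. by rewrite det_inv sl_det invr1. Qed.

Definition sl_mul A B := MkSL (sl_mul_subproof A B).
Definition sl_one := MkSL sl_one_subproof.
Definition sl_inv A := MkSL (sl_inv_subproof A).

Lemma sl_mulA : associative sl_mul.
Proof. by move=> A B C; apply: val_inj; rewrite /= mulmxA. Qed.
Lemma sl_mul1g : left_id sl_one sl_mul.
Proof. by move=> A; apply: val_inj; rewrite /= mul1mx. Qed.
Lemma sl_mulg1 : right_id sl_one sl_mul.
Proof. by move=> A; apply: val_inj; rewrite /= mulmx1. Qed.
Lemma sl_mulVg : left_inverse sl_one sl_inv sl_mul.
Proof. by move=> A; apply: val_inj; rewrite /= mulVmx ?sl_unit. Qed.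
Lemma sl_mulgV : right_inverse sl_one sl_inv sl_mul.
Proof. by move=> A; apply: val_inj; rewrite /= mulmxV ?sl_unit. Qed.

HB.instance Definition _ := isGroup.Build SL
  sl_mulA sl_mul1g sl_mulg1 sl_mulVg sl_mulgV.

End SpecialLinear.

Section Generators.
Local Open Scope ring_scope.

(* Matrix units, with row and column indices counted from 1. *)
Definition E (n i j : nat) : 'M[int]_n :=
  (\matrix_(r < n, c < n) ((r.+1 == i) && (c.+1 == j))%:R).

Definition a_mx (n : nat) : 'M[int]_n :=
  (\sum_(1 <= i < n) E n i i.+1 + (-1) ^+ n.-1 *: E n n 1).

Definition b_mx (n : nat) : 'M[int]_n := (1%:M + E n 2 1).

Lemma a_mxE n (r c : 'I_n) :
  a_mx n r c =
    ((c == r.+1 :> nat)%:R + (-1) ^+ n.-1 * ((r.+1 == n) && (c == 0 :> nat))%:R).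
Proof.
rewrite /a_mx !mxE summxE; congr (_ + _).
under eq_bigr do rewrite mxE.
have [cr|cr] := eqVneq (c : nat) r.+1.
  have r1n : r.+1 \in index_iota 1 n by rewrite mem_index_iota /= -cr.
  rewrite (bigD1_seq _ r1n (iota_uniq _ _)) /= eqxx cr eqxx big1 ?addr0 // => i.
  by rewrite eq_sym => /negbTE->.
rewrite big1 // => i _; have [ri|//] := eqVneq r.+1 i.
by rewrite -ri eqSS (negbTE cr).
Qed.

Lemma det_a_mx n : \det (a_mx n) == 1.
Proof.
case: n => [|m]; first by rewrite det_mx00.
rewrite (expand_det_col _ ord0) (bigD1 ord_max) //= big1 => [|r rmax]; last first.
  rewrite a_mxE /= andbT eqSS; have /negbTE-> : (r : nat) != m by [].
  by rewrite mulr0 addr0 mul0r.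
rewrite addr0 a_mxE /= !eqxx add0r mulr1 /cofactor addn0 mulrA.
rewrite -expr2 sqrr_sign mul1r.
suff -> : row' ord_max (col' ord0 (a_mx m.+1)) = 1%:M by rewrite det1.
apply/matrixP => r c; rewrite 2![LHS]mxE a_mxE mxE /= /bump leq0n (leqNgt m) (ltn_ord r).
by rewrite andbF mulr0 addr0 eqSS eq_sym.
Qed.

Lemma det_b_mx n : \det (b_mx n) == 1.
Proof.
rewrite det_trig; last first.
  apply/is_trig_mxP => r c rc; rewrite !mxE -val_eqE /= !eqSS.
  by rewrite (ltn_eqF rc) add0r [c == 0 :> nat]gtn_eqF ?andbF // (leq_trans _ rc).
rewrite big1 // => i _; rewrite !mxE eqxx /= !eqSS.
by case: (nat_of_ord i) => [|k]; rewrite ?andbF ?addr0.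
Qed.

End Generators.

Definition a_ (n : nat) : SL int n := MkSL (det_a_mx n).
Definition b_ (n : nat) : SL int n := MkSL (det_b_mx n).
Definition x_ (n : nat) : SL int n := a_ n * b_ n.
Definition y_ (n : nat) : SL int n := b_ n.

(* The words tau_{ij}, evaluated at two elements a, b of an arbitrary group.
   Indices are counted from 1; tau i j is meaningful for distinct i, j in
   {1, ..., n} only. *)
Section Tau.
Variables (G : groupType) (n : nat) (a b : G).

(* tau_{r+1,r} *)
Definition tau_sub (r : nat) : G := a ^- r.-1 * b * a ^+ r.-1.

Definition tau_1n : G :=
  let t := a ^- n.-1 * b * a ^+ n.-1 in if odd n then t else t^-1.

(* tau_{j+d+1,j} *)
Fixpoint tau_diag (d j : nat) : G :=
  if d is d'.+1 then [~ tau_diag d' j.+1, tau_sub j] else tau_sub j.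

(* tau_{ij} for j < i *)
Definition tau_low (i j : nat) : G := tau_diag (i - j).-1 j.

(* tau_{in} for i < n *)
Definition tau_last (i : nat) : G :=
  if i == 1%N then tau_1n else [~ tau_low i 1, tau_1n].

Definition tau (i j : nat) : G :=
  if (j < i)%N then tau_low i j
  else if j == n then tau_last i
  else [~ tau_last i, tau_low n j].

Definition idx (i : nat) : bool := (1 <= i <= n)%N.

Definition weyl (i : nat) : G := tau i i.+1 * (tau i.+1 i)^-1 * tau i i.+1.

Inductive R_rel : G -> G -> Prop :=
| R_comm i j k l :
    idx i -> idx j -> idx k -> idx l -> i != j -> k != l ->
    (i, j) != (k, l) -> i != l -> j != k ->
    R_rel [~ tau i j, tau k l] 1
| R_steinberg i j k :
    idx i -> idx j -> idx k -> i != j -> j != k -> i != k ->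
    R_rel [~ tau i j, tau j k] (tau i k)
| R_weyl4 : R_rel (weyl 1 ^+ 4) 1
| R_a : R_rel a (\prod_(i <- rev (iota 1 n.-1)) weyl i).

End Tau.

Definition Fxy := free_group bool.
Definition gx : Fxy := free_gen true.
Definition gy : Fxy := free_gen false.

Definition Pres (n : nat) := rel_quot (R_rel n (gx / gy) gy).

Definition px (n : nat) : Pres n := \pi_(Pres n) gx.
Definition py (n : nat) : Pres n := \pi_(Pres n) gy.

(* Main.v *)
From HB Require Import structures.
Require Import Defs.
From mathcomp Require Import all_boot all_order all_algebra.
From mathcomp Require Import perm zify ring.

(**
The element y_n is a transvection.  For x_n, which is a_n + E_11, the first
coordinates s_m of the vectors x_n^m e_1 satisfy
s_(m+n) - s_(m+n-1) = eps_n s_m.  If x_n had finite order, s would be periodic;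
summing squares over a period then forces s_(m+2) - s_(m+1) + s_m = 0
[periodic_recurrence], whereas s starts with 1, 1, 1.  This is an elementary form
of the remark that an eigenvalue l with |l| = |l - 1| = 1 is a primitive sixth
root of unity.

For the presentation, the words tau_ij take the values 1 + E_ij at (a_n, b_n)
[tauE], so the matrices satisfy all the relations [R_rel_SL] and there is a
homomorphism phi from the presented group to SL_n(Z).  Conversely the relations
express the generators of the presented group through its elements tau_ij
([full_a], [full_b]); these satisfy the Steinberg relations and
(tau_12 tau_21^-1 tau_12)^4 = 1.  It remains to prove the theorem of Steinberg and
Milnor that such a group G maps isomorphically onto SL_n(Z).  The proof follows
Silvester's reduction of the l1 norm of a vector.

Let A be a set of indices, z in A, and let G_A be generated by the t_ij with i, j
in A.  The key is [stabilizer]: an element of G_A whose image fixes the basis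
vector e_z lies in the subgroup [stab A z] generated by those letters t_ij that
fix e_z, that is, with j <> z.  Granting this, an x in G_A with trivial image is
u * y with u a product of letters in row z and y in G_B for B = A \ {z}
[stab_split]; comparing rows z gives u = 1 [rowz_inj], and y = 1 by induction on
the size of A.

To prove [stabilizer], cosets x * stab A z are attached to vectors v by the
relation [over v x], generated from the signed permutations of positive multiples
of e_z by left multiplication with letters that undo a reduction, that is, a step of
the Euclidean algorithm on two coordinates.
If A has at least two elements, every nonzero vector supported on A has such a coset,
by the Euclidean algorithm [over_total].  The coset is unique [over_uniq]: by induction on
the norm it is enough to compare two letters by which v can be reduced (a peak),
and each configuration of their indices is resolved by a Steinberg relation
([peak_commute], [peak_chain], [peak_swap], [peak_row]).  Uniqueness makes the
relation equivariant under every letter [over_te]: a letter t_ij that moves v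
and neither reduces it nor undoes a reduction is replaced by t_ji w_ij t_ji, where
w_ij = t_ij t_ji^-1 t_ij.  Hence if x fixes e_z, both 1 and x lie over e_z and
x is in stab A z.  The relation w^4 = 1 enters only through the vector -e_z:
it makes the cosets of the w_pz^2 agree [w2_change].

Surjectivity [phi_surj_full] is the same induction on A: [over_total] turns
column z of a matrix into e_z, and a shear clears row z.
*)

Set Implicit Arguments.
Unset Strict Implicit.
Unset Printing Implicit Defensive.

Import Order.TTheory GRing.Theory Num.Theory.
Local Open Scope group_scope.

(** * Steinberg relations and signed permutations *)

Section SteinbergCalculus.
Variables (n : nat) (G : groupType) (t : 'I_n -> 'I_n -> G).

(** A generator or its inverse, with the sign written as a bit so that signs multiply by
    exclusive or. *)
Definition te (i j : 'I_n) (e : bool) : G := if e then (t i j)^-1 else t i j.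

(** The image in SL_n(Z) is a signed transposition: it sends e_j to (-1)^e e_i and e_i
    to -(-1)^e e_j. *)
Definition w (i j : 'I_n) (e : bool) : G := te i j e * te j i (~~ e) * te i j e.

Lemma teN i j e : te i j (~~ e) = (te i j e)^-1.
Proof. by case: e => /=; rewrite ?invgK. Qed.

Lemma wN i j e : w i j (~~ e) = (w i j e)^-1.
Proof. by rewrite /w !teN !invgM !mulgA invgK. Qed.

Hypothesis n_gt2 : (2 < n)%N.
Hypothesis tC : forall i j k l, i != j -> k != l -> i != l -> j != k ->
  commute (t i j) (t k l).
Hypothesis tS : forall i j k, i != j -> j != k -> i != k ->
  [~ t i j, t j k] = t i k.

(** The letters t_ij and t_ji are conjugated by w_ij only after being written as
    commutators through a third index; this uses n >= 3. *)
Lemma third_index (i j : 'I_n) : exists m : 'I_n, (m != i) && (m != j).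
Proof.
have [m] : exists m, m \notin [set i; j].
  apply/existsP; rewrite -negb_forall; apply/negP => /forallP all_in.
  have : (#|[set: 'I_n]| <= #|[set i; j]|)%N by apply/subset_leq_card/subsetP => m _.
  by rewrite cardsT card_ord cards2; case: (_ == _) => /=; lia.
by rewrite !inE negb_or; exists m.
Qed.

Lemma teC i j k l e f : i != j -> k != l -> i != l -> j != k ->
  commute (te i j e) (te k l f).
Proof.
move=> ij kl il jk; have c := tC ij kl il jk.
case: e; case: f => //=; first by apply/commuteV/commute_sym/commuteV/commute_sym.
  exact/commute_sym/commuteV/commute_sym.
exact: commuteV.
Qed.

Lemma te_conjC i j k l e f : i != j -> k != l -> i != l -> j != k ->
  te i j e ^ te k l f = te i j e.
Proof. by move=> ij kl il jk; rewrite /conjg teC // mulKg. Qed.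

(** The relation [t_ij, t_jk] = t_ik extends to all signs because t_ik commutes with
    both factors. *)
Lemma te_conjr i j k e f : i != j -> j != k -> i != k ->
  te i j e ^ te j k f = te i j e * te i k (e (+) f).
Proof.
move=> ij jk ik.
have pos a : te i j a ^ t j k = te i j a * te i k a.
  have H : t i j ^ t j k = t i j * t i k by rewrite -(tS ij jk ik) commgEl mulVKg.
  case: a => //=; rewrite conjVg H invgM; apply: commuteV.
  by apply/commute_sym/commuteV/tC => //; rewrite eq_sym.
case: f; rewrite ?addbF ?pos //= addbT teN.
apply: (can_inj (conjgK (t j k))); rewrite conjgKV conjMg pos conjVg.
have -> : te i k e ^ t j k = te i k e.
  by apply: (@te_conjC _ _ _ _ e false) => //; rewrite eq_sym.
by rewrite mulgK.
Qed.

Lemma te_conjl i j k e f : i != j -> j != k -> i != k ->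
  te j k f ^ te i j e = te j k f * te i k (~~ (e (+) f)).
Proof.
move=> ij jk ik; rewrite -[LHS]invgK -conjVg.
suff H : te j k (~~ f) ^ te i j e = te i k (e (+) f) * te j k (~~ f).
  by rewrite teN in H; rewrite H invgM invgK teN.
apply: (mulgI (te i j e)); rewrite -conjgC conjgCV -teN te_conjr // negbK mulgA.
by congr (_ * _); rewrite teC // ?[i == j]eq_sym // eq_sym.
Qed.

Lemma te_swapS i j k e f : i != j -> j != k -> i != k ->
  te i j e * te j k f = te j k f * te i j e * te i k (e (+) f).
Proof. by move=> *; rewrite -mulgA -te_conjr // -conjgC. Qed.

(** The pair (wperm i j, wsign i j e) is the signed permutation underlying w_ij: e_k is
    sent to (-1)^(wsign k) e_(wperm k). *)
Definition wperm (i j k : 'I_n) : 'I_n := tperm i j k.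
Definition wsign (i j : 'I_n) (e : bool) (k : 'I_n) : bool :=
  if k == i then ~~ e else if k == j then e else false.

Lemma wVE i j e : (w i j e)^-1 = te i j (~~ e) * te j i e * te i j (~~ e).
Proof. by rewrite -wN /w negbK. Qed.

Lemma w_conj_out i j k l e f : i != j -> k != l ->
  k != i -> k != j -> l != i -> l != j -> te k l f ^ (w i j e)^-1 = te k l f.
Proof.
move=> ij kl ki kj li lj.
by rewrite wVE !conjgM !te_conjC // 1?eq_sym.
Qed.

(** A letter sharing exactly one index with w_ij = t_ij t_ji^-1 t_ij picks up one new
    factor from each of two of the three conjugations, and two of the three resulting
    factors cancel. *)
Lemma w_conj_jm i j m e f : i != j -> m != i -> m != j ->
  te j m f ^ (w i j e)^-1 = te i m (e (+) f).
Proof.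
move=> ij mi mj; have ji : j != i by rewrite eq_sym.
have [im jm] : i != m /\ j != m by split; rewrite eq_sym.
rewrite wVE !conjgM.
have -> : te j m f ^ te i j (~~ e) = te j m f * te i m (e (+) f).
  by rewrite te_conjl // addNb negbK.
have -> : (te j m f * te i m (e (+) f)) ^ te j i e = te i m (e (+) f).
  rewrite conjMg te_conjC // te_conjl // (@teC i m j m) // mulgA addbA addbb addFb.
  by rewrite teN mulgV mul1g.
by rewrite te_conjC.
Qed.

Lemma w_conj_im i j m e f : i != j -> m != i -> m != j ->
  te i m f ^ (w i j e)^-1 = te j m (~~ (e (+) f)).
Proof.
move=> ij mi mj; have ji : j != i by rewrite eq_sym.
have [im jm] : i != m /\ j != m by split; rewrite eq_sym.
rewrite wVE !conjgM te_conjC //.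
have -> : te i m f ^ te j i e = te i m f * te j m (~~ (e (+) f)) by rewrite te_conjl.
rewrite conjMg te_conjC // te_conjl // (@teC j m i m) // mulgA.
by rewrite addNb addbN negbK addbA addbb addFb teN mulgV mul1g.
Qed.

Lemma w_conj_mi i j m e f : i != j -> m != i -> m != j ->
  te m i f ^ (w i j e)^-1 = te m j (~~ (e (+) f)).
Proof.
move=> ij mi mj; have ji : j != i by rewrite eq_sym.
have [im jm] : i != m /\ j != m by split; rewrite eq_sym.
rewrite wVE !conjgM.
have -> : te m i f ^ te i j (~~ e) = te m i f * te m j (~~ (e (+) f)).
  by rewrite te_conjr // addbN addbC.
have -> : (te m i f * te m j (~~ (e (+) f))) ^ te j i e = te m j (~~ (e (+) f)).
  rewrite conjMg te_conjC // te_conjr // (@teC m j m i) // mulgA.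
  by rewrite addNb [e (+) f]addbC -addbA addbb addbF teN mulgV mul1g.
by rewrite te_conjC.
Qed.

Lemma w_conj_mj i j m e f : i != j -> m != i -> m != j ->
  te m j f ^ (w i j e)^-1 = te m i (e (+) f).
Proof.
move=> ij mi mj; have ji : j != i by rewrite eq_sym.
have [im jm] : i != m /\ j != m by split; rewrite eq_sym.
rewrite wVE !conjgM te_conjC //.
have -> : te m j f ^ te j i e = te m j f * te m i (e (+) f).
  by rewrite te_conjr // addbC.
rewrite conjMg te_conjC // te_conjr // (@teC m i m j) // mulgA.
by rewrite addbN [e (+) f]addbC -addbA addbb addbF teN mulgV mul1g.
Qed.

Lemma te_commutator i j k f : i != j -> j != k -> i != k ->
  te i k f = [~ te i j f, te j k false].
Proof. by move=> ij jk ik; rewrite commgEl te_conjr // mulKg addbF. Qed.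

(** Conjugation by w_ij permutes the letters as its signed permutation permutes the
    indices. When {k, l} = {i, j}, the letter is the commutator of two letters that meet
    {i, j} in one index only. *)
Lemma w_conj i j k l e f : i != j -> k != l ->
  te k l f ^ (w i j e)^-1 =
  te (wperm i j k) (wperm i j l) (f (+) wsign i j e k (+) wsign i j e l).
Proof.
move=> ij kl; have ji : j != i by rewrite eq_sym.
rewrite /wperm /wsign.
have ij' := negbTE ij; have ji' := negbTE ji.
have [m /andP[mi mj]] := third_index i j.
have [im jm] : i != m /\ j != m by split; rewrite eq_sym.
have [ki|ki] := eqVneq k i; [|have [kj|kj] := eqVneq k j];
(have [li|li] := eqVneq l i; [|have [lj|lj] := eqVneq l j]).
- by rewrite ki li eqxx in kl.
- rewrite ki lj tpermL tpermR (te_commutator f im) // conjRg w_conj_im // w_conj_mj //.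
  rewrite commgEl te_conjr // mulKg; congr te; by case: e; case: f.
- rewrite ki tpermL tpermD // 1?eq_sym // w_conj_im //.
  by congr te; case: e; case: f.
- rewrite kj li tpermL tpermR (te_commutator f jm) // conjRg w_conj_jm // w_conj_mi //.
  rewrite commgEl te_conjr // mulKg; congr te; by case: e; case: f.
- by rewrite kj lj eqxx in kl.
- rewrite kj tpermR (tpermD _ _) 1?[_ == l]eq_sym // w_conj_jm //.
  by congr te; case: e; case: f.
- rewrite li tpermL (tpermD _ _) 1?[_ == k]eq_sym // w_conj_mi //.
  by congr te; case: e; case: f.
- rewrite lj tpermR (tpermD _ _) 1?[_ == k]eq_sym // w_conj_mj //.
  by congr te; case: e; case: f.
by rewrite !(tpermD _ _) 1?eq_sym // w_conj_out // !addbF.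
Qed.

Lemma wperm_eq i j k l : (wperm i j k == wperm i j l) = (k == l).
Proof. by rewrite /wperm (inj_eq perm_inj). Qed.

Lemma w_te i j k l e f : i != j -> k != l ->
  w i j e * te k l f =
  te (wperm i j k) (wperm i j l) (f (+) wsign i j e k (+) wsign i j e l) * w i j e.
Proof. by move=> ij kl; rewrite conjgCV w_conj. Qed.

Lemma w_conj_w i j k l e f : i != j -> k != l ->
  w k l f ^ (w i j e)^-1 =
  w (wperm i j k) (wperm i j l) (f (+) wsign i j e k (+) wsign i j e l).
Proof.
move=> ij kl; rewrite [w k l f]/w !conjMg !w_conj // 1?eq_sym // /w.
by congr (_ * te _ _ _ * _); case: wsign; case: wsign; case: f.
Qed.

Lemma w_w i j k l e f : i != j -> k != l ->
  w i j e * w k l f =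
  w (wperm i j k) (wperm i j l) (f (+) wsign i j e k (+) wsign i j e l) * w i j e.
Proof. by move=> ij kl; rewrite conjgCV w_conj_w. Qed.

(** Conjugate the three factors of w_ij by w_ij itself. *)
Lemma w_self i j e : i != j ->
  w i j e = te j i (~~ e) * te i j e * te j i (~~ e).
Proof.
move=> ij; have ji : j != i by rewrite eq_sym.
have -> : w i j e = w i j e ^ (w i j e)^-1 by rewrite /conjg invgK mulgV mulg1.
rewrite [in X in X ^ _]/w !conjMg !w_conj // /wperm /wsign !tpermL !tpermR !eqxx.
by rewrite (negbTE ji); congr (te _ _ _ * te _ _ _ * te _ _ _); case: e.
Qed.

Lemma w_sym i j e : i != j -> w j i e = w i j (~~ e).
Proof. by move=> ij; rewrite (@w_self i j) // negbK. Qed.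

(** Rewrites a letter as the opposite letter, a signed permutation, and the opposite
    letter again. This deals with the letters that neither reduce a vector nor undo a
    reduction. *)
Lemma te_w i j e : i != j -> te i j e = te j i e * w i j e * te j i e.
Proof. by move=> ij; rewrite w_self // (teN j i) !mulgA mulgV mul1g mulgVK. Qed.

Hypothesis w4 : exists i j, i != j /\ w i j false ^+ 4 = 1.

Lemma w4_sign i j e f : w i j e ^+ 4 = 1 -> w i j f ^+ 4 = 1.
Proof.
have [->//|] := eqVneq e f; case: e; case: f => // _ H.
  by rewrite -[false]/(~~ true) wN expVgn H invg1.
by rewrite -[true]/(~~ false) wN expVgn H invg1.
Qed.

(** Any two of the w_ij are conjugate up to inversion, so one relation w^4 = 1 gives
    them all. *)
Lemma w4_step i j k : i != j -> k != i -> k != j ->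
  w i j false ^+ 4 = 1 -> w i k false ^+ 4 = 1.
Proof.
move=> ij ki kj H; have jk : j != k by rewrite eq_sym.
have := @w_conj_w j k i j false false jk ij; set s := _ (+) wsign _ _ _ j.
rewrite /wperm tpermL tpermD // 1?[j == i]eq_sym // => E.
by apply: (@w4_sign _ _ s); rewrite -E -conjXg H conj1g.
Qed.

Lemma w4_all i j e : i != j -> w i j e ^+ 4 = 1.
Proof.
move=> ij; apply: (@w4_sign _ _ false).
have [i0 [j0 [ij0 H0]]] := w4.
have sym a b : a != b -> w a b false ^+ 4 = 1 -> w b a false ^+ 4 = 1.
  by move=> ab H; rewrite w_sym //; apply: w4_sign H.
have row b : i0 != b -> w i0 b false ^+ 4 = 1.
  move=> ib; have [->//|bj] := eqVneq b j0.
  by apply: (w4_step ij0) => //; rewrite eq_sym.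
have [ii0|ii0] := eqVneq i i0; last first.
  have [->|ji0] := eqVneq j i0.
    by apply: sym; [rewrite eq_sym|apply: row; rewrite eq_sym].
  apply: (@w4_step _ i0) => //; first by rewrite eq_sym.
  by apply: sym; [rewrite eq_sym|apply: row; rewrite eq_sym].
by rewrite ii0; apply: row; rewrite -ii0.
Qed.

Variable phi : UMagmaMorphism.type G (SL int n).
Hypothesis phi_t : forall i j, i != j ->
  (phi (t i j) : 'M[int]_n) = (1%:M + delta_mx i j)%R.

Local Open Scope ring_scope.
(* Ring operations are the default from here on; those of G get notations of their own. *)
Local Notation "x *g y" := (@monoid.mul G x y) (at level 40, left associativity).
Local Notation "x ^+g k" := (@monoid.natexp G x k) (at level 29, left associativity).
Local Notation "1g" := (@monoid.one G).
Local Notation "x ^-g" := (@monoid.inv G x) (at level 3, format "x ^-g").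

(** * The action on column vectors *)

Definition act (x : G) (v : 'cV[int]_n) : 'cV[int]_n := (phi x : 'M[int]_n) *m v.

Implicit Types (x y g h : G) (u v : 'cV[int]_n) (i j k l : 'I_n).

Lemma act1 v : act 1g v = v.
Proof. by rewrite /act gmulf1 mul1mx. Qed.

Lemma actM x y v : act (x *g y) v = act x (act y v).
Proof. by rewrite /act gmulfM mulmxA. Qed.

Lemma actK x v : act x^-g (act x v) = v.
Proof. by rewrite -actM mulVg act1. Qed.

Lemma actVK x v : act x (act x^-g v) = v.
Proof. by rewrite -actM mulgV act1. Qed.

Lemma actZ x m v : act x (m *: v) = m *: act x v.
Proof. by rewrite /act -scalemxAr. Qed.

Lemma act0 x : act x 0 = 0.
Proof. by rewrite /act mulmx0. Qed.

Definition sg (e : bool) (a : int) : int := if e then - a else a.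

Lemma act_te i j e v : i != j ->
  act (te i j e) v = v + sg e (v j 0) *: delta_mx i 0.
Proof.
move=> ij.
have pos u : act (t i j) u = u + u j 0 *: delta_mx i 0.
  rewrite /act phi_t // mulmxDl mul1mx; congr (_ + _).
  apply/colP => k; rewrite !mxE (bigD1 j) //= big1 => [|k' k'j]; last first.
    by rewrite !mxE (negbTE k'j) andbF mul0r.
  by rewrite !mxE eqxx !andbT addr0 mulrC.
case: e => /=; last exact: pos.
rewrite -{1}(subrK (v j 0 *: delta_mx i 0) v) scaleNr.
set u := v - _; have uj : u j 0 = v j 0.
  by rewrite !mxE [j == i]eq_sym (negbTE ij) mulr0 subr0.
by rewrite -uj -pos actK.
Qed.

Lemma act_te_at i j e v : i != j -> act (te i j e) v i 0 = v i 0 + sg e (v j 0).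
Proof. by move=> ij; rewrite act_te // !mxE !eqxx mulr1. Qed.

Lemma act_te_off i j e v k : i != j -> k != i -> act (te i j e) v k 0 = v k 0.
Proof. by move=> ij ki; rewrite act_te // !mxE (negbTE ki) mulr0 addr0. Qed.

Lemma act_w i j e v k : i != j ->
  act (w i j e) v (wperm i j k) 0 = sg (wsign i j e k) (v k 0).
Proof.
move=> ij; have ji : j != i by rewrite eq_sym.
rewrite /w !actM /wperm /wsign.
have [->|ki] := eqVneq k i.
  rewrite tpermL (act_te_off _ _ ij ji) (act_te_at _ _ ji) (act_te_off _ _ ij ji).
  rewrite (act_te_at _ _ ij).
  by case: e => /=; lia.
have [->|kj] := eqVneq k j.
  rewrite tpermR (act_te_at _ _ ij) (act_te_off _ _ ji ij) (act_te_at _ _ ji).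
  rewrite (act_te_at _ _ ij) (act_te_off _ _ ij ji).
  by case: e => /=; lia.
by rewrite tpermD 1?eq_sym // !act_te_off.
Qed.

Lemma act_w_fst i j e v : i != j -> act (w i j e) v i 0 = sg e (v j 0).
Proof.
move=> ij; have := act_w e v j ij; rewrite /wperm tpermR /wsign eqxx.
by rewrite eq_sym (negbTE ij).
Qed.

Lemma act_w_snd i j e v : i != j -> act (w i j e) v j 0 = sg (~~ e) (v i 0).
Proof. by move=> ij; have := act_w e v i ij; rewrite /wperm tpermL /wsign eqxx. Qed.

Lemma wpermK i j : involutive (wperm i j).
Proof. by move=> k; rewrite /wperm tpermK. Qed.

Lemma wperm_in (B : {set 'I_n}) i j k :
  i \in B -> j \in B -> (wperm i j k \in B) = (k \in B).
Proof. by move=> iB jB; rewrite /wperm; case: tpermP => [->|->|//]; rewrite iB jB. Qed.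

(** The submonoid generated by S, which is a subgroup when S is closed under inverses.
    Products are built by left multiplication, so that induction on a word follows its
    action on column vectors. *)
Inductive gen (S : G -> Prop) : G -> Prop :=
| gen1 : gen S 1g
| genM s g : S s -> gen S g -> gen S (s *g g).

Lemma gen_sub (S S' : G -> Prop) g :
  (forall s, S s -> S' s) -> gen S g -> gen S' g.
Proof. by move=> SS'; elim=> [|s h /SS' ? _ ?]; [exact: gen1|exact: genM]. Qed.

Lemma gen_in (S : G -> Prop) s : S s -> gen S s.
Proof. by move=> Ss; rewrite -(mulg1 s); apply: genM => //; apply: gen1. Qed.

Lemma gen_mul S g h : gen S g -> gen S h -> gen S (g *g h).
Proof.
by move=> Sg Sh; elim: Sg => [|s k Ss _ IH]; rewrite ?mul1g // -mulgA; apply: genM.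
Qed.

Lemma gen_inv (S : G -> Prop) g : (forall s, S s -> S s^-g) -> gen S g -> gen S g^-g.
Proof.
move=> SV; elim=> [|s k Ss _ IH]; first by rewrite invg1; apply: gen1.
by rewrite invgM; apply: gen_mul => //; apply/gen_in/SV.
Qed.

Definition letter (P : rel 'I_n) (x : G) :=
  exists i j e, [/\ i != j, P i j & x = te i j e].

Lemma letterV P s : letter P s -> letter P s^-g.
Proof. by move=> [i [j [e [ij Pij ->]]]]; exists i, j, (~~ e); rewrite teN. Qed.

Definition full (A : {set 'I_n}) := gen (letter [rel i j | (i \in A) && (j \in A)]).

(** * Signed permutations and stabilizers *)

Section Stabilizer.
Variables (A : {set 'I_n}) (z : 'I_n).
Hypothesis zA : z \in A.

Let P (i j : 'I_n) := [&& i \in A, j \in A & j != z].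
(** The letters t_ij with j <> z are those whose matrix fixes e_z. *)
Definition stab := gen (letter P).
Definition weyl_letter (x : G) :=
  exists i j e, [/\ i != j, i \in A, j \in A & x = w i j e].
Definition weylA := gen weyl_letter.

Lemma stab1 : stab 1g. Proof. exact: gen1. Qed.
Lemma stabM g h : stab g -> stab h -> stab (g *g h). Proof. exact: gen_mul. Qed.
Lemma stabV g : stab g -> stab g^-g.
Proof. by apply: gen_inv; apply: letterV. Qed.

Lemma stab_te i j e : i != j -> i \in A -> j \in A -> j != z -> stab (te i j e).
Proof. by move=> ij iA jA jz; apply: gen_in; exists i, j, e; rewrite /P iA jA jz. Qed.

Lemma stab_w i j e :
  i != j -> i \in A -> j \in A -> i != z -> j != z -> stab (w i j e).
Proof.
by move=> ij iA jA iz jz; rewrite /w; do !apply: stabM; apply: stab_te; rewrite // eq_sym.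
Qed.

Lemma weylAV g : weylA g -> weylA g^-g.
Proof.
apply: gen_inv => s [i [j [e [ij iA jA ->]]]].
by exists i, j, (~~ e); rewrite wN.
Qed.

Lemma act_stab h v m : stab h -> v = m *: delta_mx z 0 -> act h v = v.
Proof.
move=> + ->; elim=> [|s g [i [j [e [ij /and3P[_ _ jz] ->]]]] _ IH]; first exact: act1.
by rewrite actM IH act_te // !mxE (negbTE jz) mulr0; case: e; rewrite /= ?oppr0 scale0r addr0.
Qed.

(** This is where w^4 = 1 is used. *)
Lemma w2_sign a b e f : a != b -> w a b e ^+g 2 = w a b f ^+g 2.
Proof.
move=> ab; have [->//|] := eqVneq e f => ef.
have -> : e = ~~ f by case: e f ef => [] [].
rewrite wN expVgn; apply/mulg1_eq/eqP.
by rewrite -expgnDr w4_all.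
Qed.

(** The squares w_pz^2 all send e_z to -e_z. Conjugation by w_qz sends w_pz^2 to w_pq^2,
    while w_pq^2 inverts w_qz under conjugation. *)
Lemma w2_change p q e : p != q -> p != z -> q != z ->
  w p z e ^+g 2 = (w q z e ^+g 2) *g (w p q e ^+g 2).
Proof.
move=> pq pz qz; have zq : z != q by rewrite eq_sym.
have zp : z != p by rewrite eq_sym.
have qp : q != p by rewrite eq_sym.
have := @w_conj_w q z p z e e qz pz.
set s := _ (+) _ (+) _; rewrite /wperm tpermR tpermD // => E.
have E2 : conjg (w p z e ^+g 2) (w q z e)^-g = w p q e ^+g 2.
  by rewrite conjXg E; apply: w2_sign.
have X : (w p q e ^+g 2) *g w q z e = w q z (~~ e) *g (w p q e ^+g 2).
  rewrite expg2 -mulgA w_w // mulgA w_w //; last by rewrite wperm_eq.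
  rewrite -mulgA !wpermK; congr (w _ _ _ *g _).
  rewrite /wperm tpermR tpermD // /wsign !eqxx (negbTE qp) (negbTE zp) (negbTE zq).
  by case: e {E E2 s}.
rewrite -[LHS](conjgKV (w q z e)) E2 conjgE X -wN mulgA -expg2.
by rewrite (w2_sign (~~ e) e).
Qed.

(** Representatives of the signed permutations modulo stab: their images of e_z are e_z,
    -e_z and (-1)^s e_a respectively. The representative in [Weyl_neg] depends on a
    choice of p, which [w2_change] shows to be harmless. *)
Variant weyl_coset (x : G) : Prop :=
| Weyl_id of stab x
| Weyl_neg p h of p \in A & p != z & stab h & x = (w p z false ^+g 2) *g h
| Weyl_move a s h of a \in A & a != z & stab h & x = w a z s *g h.

(** The listed cosets are permuted by left multiplication by the w_ij. If neither index
    is z, move w_ij to the right by conjugation, where it lies in stab; if one index is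
    z, the product of two representatives is recomputed. *)
Lemma weylA_coset x : weylA x -> weyl_coset x.
Proof.
elim=> [|y g [i [j [e [ij iA jA ->]]]] _ IH]; first exact/Weyl_id/stab1.
wlog iz : i j e ij iA jA / i != z => [H|].
  have [iz|iz] := eqVneq i z; last exact: H.
  rewrite -[e]negbK -(w_sym _ ij); by apply: H; rewrite // -?iz eq_sym.
have [jz|jz] := eqVneq j z.
  case: IH => [Hg|p h pA pz Hh ->|a s h aA az Hh ->].
  - by rewrite jz; apply: (@Weyl_move _ i e g).
  - have [k Hk Ek] : exists2 k, stab k & w p z false ^+g 2 = w i z (~~ e) ^+g 2 *g k.
      have [->|pi] := eqVneq p i; first by exists 1g; [exact: stab1|rewrite mulg1; apply: w2_sign].
      exists (w p i (~~ e) ^+g 2); first by rewrite expg2; apply: stabM; apply: stab_w.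
      by rewrite -w2_change //; apply: w2_sign.
    apply: (@Weyl_move _ i (~~ e) (k *g h)) => //; first exact: stabM.
    by rewrite Ek jz wN expg2 !mulgA mulgV mul1g.
  - have [ai|ai] := eqVneq a i.
      have [es|es] := eqVneq e s.
        apply: (@Weyl_neg _ i h) => //; rewrite jz ai es mulgA -expg2.
        by congr (_ *g _); apply: w2_sign.
      apply: Weyl_id; rewrite jz ai.
      have -> : s = ~~ e by case: e es; case: s.
      by rewrite wN mulVKg.
    have ia : i != a by rewrite eq_sym.
    have zi : z != i by rewrite eq_sym.
    (* The sign of w_ia is chosen so that w_ia becomes w_iz with sign e when it is moved across w_az. *)
    have := @w_w a z i a s (e (+) wsign a z s i (+) wsign a z s a) az ia.
    rewrite {1}/wperm tpermD 1?eq_sym // {1}/wperm tpermL.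
    have -> b c d : b (+) c (+) d (+) c (+) d = b by case: b; case: c; case: d.
    move=> E; rewrite jz mulgA -E -mulgA.
    set f := _ (+) wsign a z s a in E *.
    by apply: (@Weyl_move _ a s (w i a f *g h)) => //; apply: stabM => //; apply: stab_w.
have Hw f : stab (w i j f) by apply: stab_w.
have Ez : wperm i j z = z by rewrite /wperm tpermD.
have Ep p : p != z -> wperm i j p != z by rewrite -{2}Ez wperm_eq.
case: IH => [Hg|p h pA pz Hh ->|a s h aA az Hh ->].
- exact/Weyl_id/stabM.
- apply: (@Weyl_neg _ (wperm i j p) (w i j e *g h)); rewrite ?wperm_in ?Ep //.
    exact: stabM.
  rewrite mulgA (conjgCV (w i j e) (w p z false ^+g 2)) conjXg w_conj_w // Ez -mulgA.
  by rewrite (@w2_sign _ _ _ false) // Ep.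
- apply: (@Weyl_move _ (wperm i j a) (s (+) wsign i j e a (+) wsign i j e z) (w i j e *g h)).
  + by rewrite wperm_in.
  + exact: Ep.
  + exact: stabM.
  by rewrite mulgA (w_w _ _ ij az) Ez -mulgA.
Qed.

(** The stabilizer theorem for signed permutations, allowing for positive multiples: of
    the three kinds of cosets only the first sends e_z to a positive multiple of itself.
    *)
Lemma weylA_stab x m1 m2 : 0 < m1 -> 0 < m2 -> weylA x ->
  m1 *: delta_mx z 0 = act x (m2 *: delta_mx z 0) -> stab x.
Proof.
move=> m1_gt0 m2_gt0 /weylA_coset[//|p h pA pz Hh ->|a s h aA az Hh ->] /colP /(_ z).
  rewrite actM (act_stab Hh (erefl _)) expg2 actM act_w_snd // act_w_fst //.
  by rewrite !mxE !eqxx /=; lia.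
rewrite actM (act_stab Hh (erefl _)) act_w_snd // !mxE !eqxx (negbTE az) /= mulr0.
by case: s => /=; lia.
Qed.

(** * Cosets attached to vectors *)

(** Here b can be reduced by subtracting a without a change of sign. Steps that shorten
    b by overshooting 0 do not count as reductions; this keeps the peaks below few and
    uniform. *)
Definition down (a b : int) := (0 < a <= b) || (b <= a < 0).

Lemma sgN e a : sg (~~ e) a = - sg e a.
Proof. by case: e; rewrite /= ?opprK. Qed.

Lemma sgB e a b : sg e (a - b) = sg e a - sg e b.
Proof. by case: e; rewrite /= ?opprB // opprK addrC. Qed.

Lemma down_neq0 e a b : down (sg e a) b -> a != 0 /\ b != 0.
Proof. by rewrite /down; case: e => /=; lia. Qed.

Lemma down_sign e f a b : down (sg e a) b -> down (sg f a) b -> e = f.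
Proof. by rewrite /down; case: e; case: f => //=; lia. Qed.

Lemma down_flip e c d a b : down (sg e a) b ->
  down (sg (e (+) c (+) d) (sg d a)) (sg c b).
Proof. by rewrite /down; case: e; case: c; case: d => /=; lia. Qed.

(** If a and c both reduce b and |c| <= |a|, then c reduces a up to sign, since a and c
    have the sign of b. *)
Lemma down_row e f a b c : down (sg e a) b -> down (sg f c) b -> `|c| <= `|a| ->
  down (sg (e (+) f) c) a.
Proof. by rewrite /down; case: e; case: f => /=; lia. Qed.

(** Sign conditions needed in [peak_chain]: when a, b, c have equal signs and |a| <= |b|
    <= |c|, the differences b - a and c - b have that sign or vanish; the bits e and f
    account for other signs. *)
Lemma down_chain e f a b c : down (sg e a) b -> down (sg f b) c ->
  0 <= sg f (b - sg e a) * (c - sg f b) /\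
  0 <= sg (e (+) f) a * (c - sg f (sg e a)).
Proof.
rewrite /down => d1 d2.
have sum : c - sg f (sg e a) = sg f (b - sg e a) + (c - sg f b).
  by rewrite sgB; ring.
have [[p q r]|[p q r]] :
    [/\ 0 <= sg f (b - sg e a), 0 <= c - sg f b & 0 <= sg (e (+) f) a] \/
    [/\ sg f (b - sg e a) <= 0, c - sg f b <= 0 & sg (e (+) f) a <= 0].
- by case: (ltP 0 c) => c0; [left|right]; case: e d1 {sum}; case: f d2 => /= d2 d1; split; lia.
- by rewrite sum; split; apply: mulr_ge0 => //; apply: addr_ge0.
by rewrite sum; split; apply: mulr_le0 => //; apply: le_trans (lerD p q) _.
Qed.

Lemma down_swap e f a b : down (sg e a) b -> down (sg f b) a -> f = e /\ b = sg e a.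
Proof. by rewrite /down; case: e; case: f => /=; lia. Qed.

(** [over v x] says that the coset x * stab is attached to v. Positive multiples of e_z
    are attached to the coset of 1, signed permutations carry this to multiples of the
    other basis vectors, and a letter is applied whenever it undoes a reduction. *)
Inductive over (v : 'cV[int]_n) (x : G) : Prop :=
| over_base m y h of 0 < m & weylA y & stab h &
    v = m *: act y (delta_mx z 0) & x = y *g h
| over_step i j e y of i != j & i \in A & j \in A &
    down (sg e (v j 0)) (v i 0) & over (act (te i j (~~ e)) v) y & x = te i j e *g y.

Definition supp (v : 'cV[int]_n) := forall k, k \notin A -> v k 0 = 0.

(** The l1 norm. *)
Definition norm (v : 'cV[int]_n) : nat := (\sum_k `|(v k 0)%R|)%N.

Lemma act_teN i j e v : act (te i j e) (act (te i j (~~ e)) v) = v.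
Proof. by rewrite teN actVK. Qed.

Lemma norm_down i j e v : i != j -> down (sg e (v j 0)) (v i 0) ->
  (norm (act (te i j (~~ e)) v) < norm v)%N.
Proof.
move=> ij d; rewrite /norm (bigD1 i) //= [X in (_ < X)%N](bigD1 i) //=.
under eq_bigr => k ki do rewrite act_te_off //.
rewrite ltn_add2r act_te_at //; move: d; rewrite /down.
by case: e => /=; lia.
Qed.

Lemma norm_ind (Q : 'cV[int]_n -> Prop) :
  (forall v, (forall u, (norm u < norm v)%N -> Q u) -> Q v) -> forall v, Q v.
Proof.
move=> step v; have [N] := ubnP (norm v); elim: N => // N IH in v *.
by rewrite ltnS => vN; apply: step => u uv; apply: IH; apply: leq_trans uv vN.
Qed.

Lemma over_stab v x h : over v x -> stab h -> over v (x *g h).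
Proof.
elim=> {v x} [v x m y k m0 Wy Hk Ev -> Hh|v x i j e y ij iA jA d _ IH -> Hh].
  by apply: (@over_base _ _ m y (k *g h)) => //; [exact: stabM|rewrite mulgA].
by apply: (@over_step _ _ i j e (y *g h)) => //; [exact: IH|rewrite mulgA].
Qed.

Lemma over_act v x : over v x -> exists2 m, 0 < m & v = m *: act x (delta_mx z 0).
Proof.
elim=> {v x} [v x m y k m0 Wy Hk -> ->|v x i j e y ij iA jA d _ [m m0 E] ->].
  by exists m => //; rewrite actM (@act_stab k _ 1) // scale1r.
by exists m => //; rewrite actM -actZ -E act_teN.
Qed.

Lemma over_neq0 v x : over v x -> v <> 0.
Proof.
move=> /over_act[m m0 ->] /(congr1 (act x^-g)); rewrite actZ actK act0 => /colP/(_ z).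
by rewrite !mxE !eqxx mulr1; lia.
Qed.

Lemma weylA_basis y : weylA y -> exists2 a, a \in A &
  forall k, k != a -> act y (delta_mx z 0) k 0 = 0.
Proof.
elim=> [|s g [i [j [e [ij iA jA ->]]]] _ [a aA IH]].
  by exists z => // k kz; rewrite act1 !mxE (negbTE kz).
exists (wperm i j a); first by rewrite wperm_in.
move=> k; rewrite -(wpermK i j k) wperm_eq => /IH ka.
by rewrite actM act_w // ka; case: wsign; rewrite /= ?oppr0.
Qed.

Lemma over_supp v x : over v x -> supp v.
Proof.
elim=> {v x} [v x m y h m0 /weylA_basis[a aA ya] Hh -> _ k kA|v x i j e y ij iA jA d _ IH _ k kA].
  by rewrite mxE ya ?mulr0 //; apply: contraNneq kA => ->.
have ki : k != i by apply: contraNneq kA => ->.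
by rewrite -(act_teN i j e v) (act_te_off _ _ ij ki) IH.
Qed.

(** Signed permutations preserve reducibility, since they permute the coordinates up to
    sign and conjugate the letters accordingly. *)
Lemma over_weyl i j e v x : i != j -> i \in A -> j \in A ->
  over v x -> over (act (w i j e) v) (w i j e *g x).
Proof.
move=> ij iA jA; elim=> {v x} [v x m y h m0 Wy Hh -> ->|v x k l f y kl kA lA d _ IH ->].
  apply: (@over_base _ _ m (w i j e *g y) h) => //.
  - by apply: genM => //; exists i, j, e.
  - by rewrite actM actZ.
  by rewrite mulgA.
pose g := f (+) wsign i j e k (+) wsign i j e l.
apply: (@over_step _ _ (wperm i j k) (wperm i j l) g (w i j e *g y)).
- by rewrite wperm_eq.
- by rewrite wperm_in.
- by rewrite wperm_in.
- by rewrite !act_w //; apply: down_flip.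
- have E : te (wperm i j k) (wperm i j l) (~~ g) *g w i j e = w i j e *g te k l (~~ f).
    by rewrite w_te // /g !addNb.
  by rewrite -actM E actM.
by rewrite mulgA (w_te _ _ ij kl) -mulgA.
Qed.

(** Moving a letter to the right across a signed permutation; the last clause records
    how the column index is transformed, as seen by the action on vectors. *)
Lemma weylA_te y k l f : weylA y -> k != l -> k \in A -> l \in A ->
  exists k' l' f', [/\ k' != l', k' \in A, l' \in A,
    te k l f *g y = y *g te k' l' f' &
    forall v, act y v l 0 = 0 -> v l' 0 = 0].
Proof.
move=> Wy; elim: Wy k l f => [|s g [i [j [e [ij iA jA ->]]]] _ IH] k l f kl kA lA.
  by exists k, l, f; split => // [|v]; rewrite ?mulg1 ?mul1g ?act1.
have kl' : wperm i j k != wperm i j l by rewrite wperm_eq.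
pose f1 := f (+) wsign i j e (wperm i j k) (+) wsign i j e (wperm i j l).
have [||k' [l' [f' [H1 H2 H3 H4 H5]]]] := IH _ _ f1 kl'; rewrite ?wperm_in //.
exists k', l', f'; split=> //.
  rewrite mulgA (_ : te k l f *g w i j e = w i j e *g te (wperm i j k) (wperm i j l) f1).
    by rewrite -mulgA H4 mulgA.
  rewrite w_te // !wpermK; congr (te _ _ _ *g _).
  by rewrite /f1; case: f {f1 H4}; do 2 case: wsign.
move=> v; rewrite actM -{1}(wpermK i j l) act_w // => H; apply: H5.
by move: H; case: wsign => //= /eqP; rewrite oppr_eq0 => /eqP.
Qed.

(** The letter t_kl fixes v when v_l = 0. Push it through the letter t_ij that reduces
    v: it commutes with t_ij, or produces one more letter t_il in the same column l; all
    of them fix the reduced vector. *)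
Lemma over_fix v x k l f : k != l -> k \in A -> l \in A -> v l 0 = 0 ->
  over v x -> over v (te k l f *g x).
Proof.
elim/norm_ind: v => v IH in x k l f *; move=> kl kA lA vl.
case=> [m y h m0 Wy Hh Ev ->|i j e y ij iA jA d Ry ->].
  have [k' [l' [f' [H1 H2 H3 H4 H5]]]] := weylA_te f Wy kl kA lA.
  rewrite mulgA H4 -mulgA; apply: (@over_base _ _ m y (te k' l' f' *g h)) => //.
  apply: stabM => //; apply: stab_te => //.
  apply/eqP => l'z; have /H5 : act y (m *: delta_mx z 0) l 0 = 0 by rewrite actZ -Ev.
  by rewrite l'z !mxE !eqxx; lia.
have [vj vi] := down_neq0 d.
have il : i != l by apply: contraNneq vi => ->; rewrite vl.
have jl : j != l by apply: contraNneq vj => ->; rewrite vl.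
have v1l : act (te i j (~~ e)) v l 0 = 0 by rewrite act_te_off // eq_sym.
have lt := norm_down ij d.
have [kj|kj] := eqVneq k j.
  have E : te j l f *g te i j e = te i j e *g (te j l f *g te i l (~~ (e (+) f))).
    by rewrite conjgC te_conjl.
  rewrite kj mulgA E -!mulgA.
  by apply: over_step d _ (erefl _) => //; apply: (IH) => //; apply: IH.
have E : te k l f *g te i j e = te i j e *g te k l f.
  by apply: teC => //; rewrite eq_sym.
rewrite mulgA E -mulgA.
by apply: over_step d _ (erefl _) => //; apply: IH.
Qed.

(** A letter that either fixes v or undoes a reduction. *)
Lemma over_up v x i j e : i != j -> i \in A -> j \in A ->
  0 <= sg e (v j 0) * v i 0 -> over v x -> over (act (te i j e) v) (te i j e *g x).
Proof.
move=> ij iA jA up Rx.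
have [vj|vj] := eqVneq (v j 0) 0.
  rewrite act_te // vj (_ : sg e 0 = 0) ?scale0r ?addr0; last by case: e {up}.
  exact: over_fix.
have ji : j != i by rewrite eq_sym.
apply: (@over_step _ _ i j e x) => //.
  rewrite act_te_at // act_te_off //; move: up vj; rewrite /down.
  by case: e => /=; nia.
by rewrite -{2}[e]negbK act_teN.
Qed.

Lemma act_w_basis i j e c : i != j ->
  act (w i j e) (c *: delta_mx j 0) = sg e c *: delta_mx i 0.
Proof.
move=> ij; apply/colP => k; rewrite -(wpermK i j k) act_w // !mxE.
have -> : (wperm i j (wperm i j k) == i) = (wperm i j k == j).
  by rewrite -(wperm_eq i j _ j) /wperm tpermR.
rewrite /wsign; have [->|kj] := eqVneq (wperm i j k) j.
  by rewrite eq_sym (negbTE ij) !mulr1.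
by rewrite !mulr0; case: ifP => _; case: (e).
Qed.

(** A negative multiple of e_z is reached through another basis vector; this is why A
    must have a second element. *)
Lemma over_basis a c : (1 < #|A|)%N -> a \in A -> c != 0 ->
  exists x, over (c *: delta_mx a 0) x.
Proof.
move=> A_gt1 aA c0.
have pos m : 0 < m -> over (m *: delta_mx z 0) 1g.
  move=> m0; apply: (@over_base _ _ m 1g 1g); rewrite ?act1 ?mulg1 //; first exact: gen1.
  exact: stab1.
have off b d : b \in A -> b != z -> d != 0 -> exists x, over (d *: delta_mx b 0) x.
  move=> bA bz d0; have m0 : 0 < `|d| by rewrite normr_gt0.
  have := over_weyl (d < 0) bz bA zA (pos _ m0); rewrite act_w_basis //.
  have -> : sg (d < 0) `|d| = d by rewrite /sg; case: ltP; lia.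
  by move=> ?; eexists; eassumption.
have [az|] := eqVneq a z; last by move=> az; apply: off.
rewrite az; have [c_gt0|c_le0] := ltP 0 c; first by exists 1g; apply: pos.
have [b] : exists b, b \in A :\ z.
  by apply/card_gt0P; move: A_gt1; rewrite (cardsD1 z) zA.
rewrite !inE => /andP[bz bA]; have zb : z != b by rewrite eq_sym.
have [x Rx] := off _ _ bA bz c0; exists (w z b false *g x).
by have := over_weyl false zb zA bA Rx; rewrite act_w_basis.
Qed.

Lemma supp_te i j e v : i != j -> i \in A -> supp v -> supp (act (te i j e) v).
Proof.
move=> ij iA vA k kA; rewrite act_te_off //; first exact: vA.
by apply: contraNneq kA => ->.
Qed.

Lemma act_neq0 x v : v <> 0 -> act x v <> 0.
Proof. by move=> v0 /(congr1 (act x^-g)); rewrite actK act0. Qed.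

(** The Euclidean algorithm: two nonzero coordinates can be used to reduce each other,
    and a nonzero vector with a single nonzero coordinate is covered by [over_basis]. *)
Lemma over_total v : (1 < #|A|)%N -> v <> 0 -> supp v -> exists x, over v x.
Proof.
move=> A_gt1; elim/norm_ind: v => v IH v0 vA.
have inA k : v k 0 != 0 -> k \in A by apply: contraNT => /vA ->.
have [/existsP[i /existsP[j /and4P[ij vi vj ji]]]|none] :=
  boolP [exists i, exists j, [&& i != j, v i 0 != 0, v j 0 != 0 & `|v j 0| <= `|v i 0|]].
  (* The sign for which the letter subtracts |v_j| from |v_i|. *)
  pose e := (v i 0 < 0) (+) (v j 0 < 0).
  have d : down (sg e (v j 0)) (v i 0).
    rewrite /down /e; case: (ltP (v i 0) 0) => ?; case: (ltP (v j 0) 0) => ? /=; lia.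
  have [|||y Ry] := IH (act (te i j (~~ e)) v).
  - exact: norm_down.
  - exact: act_neq0.
  - by apply: supp_te => //; apply: inA.
  by exists (te i j e *g y); apply: over_step d Ry (erefl _) => //; apply: inA.
have one i j : i != j -> v i 0 != 0 -> v j 0 = 0.
  move=> ij vi; apply/eqP; apply: contraNT none => vj.
  case: (leP `|v j 0| `|v i 0|) => [|/ltW] le.
    by apply/existsP; exists i; apply/existsP; exists j; rewrite ij vi vj.
  by apply/existsP; exists j; apply/existsP; exists i; rewrite eq_sym ij vi vj.
have [a va] : exists a, v a 0 != 0.
  apply/existsP; apply: contra_notT v0; rewrite negb_exists => /forallP vz.
  by apply/colP => k; rewrite mxE; have := vz k; rewrite negbK => /eqP.
have [x Rx] := over_basis A_gt1 (inA _ va) va; exists x.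
suff <- : v a 0 *: delta_mx a 0 = v by [].
apply/colP => k; rewrite !mxE andbT; have [->|ka] := eqVneq k a; first by rewrite mulr1.
by rewrite mulr0 (one a) // eq_sym.
Qed.

Definition same_coset x y := stab (x^-g *g y).

Lemma same_coset_refl x : same_coset x x. Proof. by rewrite /same_coset mulVg; apply: stab1. Qed.

Lemma same_coset_sym x y : same_coset x y -> same_coset y x.
Proof. by move/stabV; rewrite invgM invgK. Qed.

Lemma same_coset_trans y x g : same_coset x y -> same_coset y g -> same_coset x g.
Proof. by move=> xy yg; have := stabM xy yg; rewrite -mulgA mulVKg. Qed.

Lemma same_coset_mull g x y : same_coset x y -> same_coset (g *g x) (g *g y).
Proof. by rewrite /same_coset invgM -mulgA mulKg. Qed.

Lemma over_same_coset v x y : same_coset x y -> over v x -> over v y.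
Proof. by move=> xy /over_stab/(_ xy); rewrite mulVKg. Qed.

(** * Uniqueness of the coset *)

(** Two reductions of v lead to the same coset over v, for at least one choice of cosets
    over the reduced vectors. *)
Definition peak v i j e k l f := exists x y,
  [/\ over (act (te i j (~~ e)) v) x, over (act (te k l (~~ f)) v) y &
      same_coset (te i j e *g x) (te k l f *g y)].

Lemma peak_sym v i j e k l f : peak v i j e k l f -> peak v k l f i j e.
Proof. by move=> [x [y [? ? /same_coset_sym ?]]]; exists y, x. Qed.

Section Peaks.
Variable v : 'cV[int]_n.
Hypotheses (A_gt1 : (1 < #|A|)%N) (v0 : v <> 0) (vA : supp v).

(** The reductions act on different rows and the letters commute, so either can be done
    after the other. *)
Lemma peak_commute i j e k l f : i \in A -> j \in A -> k \in A -> l \in A ->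
  i != j -> k != l -> i != l -> j != k -> i != k ->
  down (sg e (v j 0)) (v i 0) -> down (sg f (v l 0)) (v k 0) -> peak v i j e k l f.
Proof.
move=> iA jA kA lA ij kl il jk ik d1 d2.
have [ki li] : k != i /\ l != i by split; rewrite eq_sym.
have E a b : te i j a *g te k l b = te k l b *g te i j a by apply: teC.
have [||x Rx] := @over_total (act (te k l (~~ f)) (act (te i j (~~ e)) v)) A_gt1.
- by do 2 apply: act_neq0.
- by do 2 apply: supp_te => //.
exists (te k l f *g x), (te i j e *g x); split.
- by apply: over_step (Rx) (erefl _); rewrite ?act_te_off.
- apply: over_step (erefl _); rewrite ?(act_te_off _ _ kl ik) ?(act_te_off _ _ kl jk) //.
  by rewrite -actM E actM.
by rewrite !mulgA E; apply: same_coset_refl.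
Qed.

(** Here |v_j| <= |v_i| <= |v_k|. Subtracting row j from i and row i from k in the two
    orders differs by subtracting row j from k, as [t_ki, t_ij] = t_kj says. *)
Lemma peak_chain i j e k f : i \in A -> j \in A -> k \in A ->
  i != j -> k != i -> j != k ->
  down (sg e (v j 0)) (v i 0) -> down (sg f (v i 0)) (v k 0) -> peak v i j e k i f.
Proof.
move=> iA jA kA ij ki jk d1 d2.
have [ik kj] : i != k /\ k != j by split; rewrite eq_sym.
set v2 := act (te k i (~~ f)) v.
set v3 := act (te i j (~~ e)) v2.
have [||x Rx] := @over_total v3 A_gt1.
- by do 2 apply: act_neq0.
- by do 2 apply: supp_te => //.
have R2 : over v2 (te i j e *g x).
  by apply: over_step (Rx) (erefl _); rewrite ?(act_te_off _ _ ki ik) ?(act_te_off _ _ ki jk).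
have E : te k i f *g te i j e = te i j e *g (te k j (e (+) f) *g te k i f).
  by rewrite te_swapS // -mulgA (@teC k i k j) // addbC.
have v3i : v3 i 0 = v i 0 - sg e (v j 0).
  by rewrite /v3 (act_te_at _ _ ij) /v2 (act_te_off _ _ ki ik) (act_te_off _ _ ki jk) sgN.
have v3k : v3 k 0 = v k 0 - sg f (v i 0).
  by rewrite /v3 (act_te_off _ _ ij ki) /v2 (act_te_at _ _ ki) sgN.
have v3j : v3 j 0 = v j 0.
  have ji : j != i by rewrite eq_sym.
  by rewrite /v3 (act_te_off _ _ ij ji) /v2 (act_te_off _ _ ki jk).
set v' := act (te k i f) v3.
have R' : over v' (te k i f *g x).
  by apply: over_up => //; rewrite v3i v3k; have [] := down_chain d1 d2.
have v'j : v' j 0 = v j 0 by rewrite /v' (act_te_off _ _ ki jk) v3j.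
have v'k : v' k 0 = v k 0 - sg f (sg e (v j 0)).
  by rewrite /v' (act_te_at _ _ ki) v3i v3k sgB addrA subrK.
have R1 : over (act (te k j (e (+) f)) v') (te k j (e (+) f) *g (te k i f *g x)).
  by apply: over_up => //; rewrite v'j v'k; have [] := down_chain d1 d2.
exists (te k j (e (+) f) *g (te k i f *g x)), (te i j e *g x); split => //.
  suff <- : act (te k j (e (+) f)) v' = act (te i j (~~ e)) v by [].
  rewrite -[in RHS](act_teN k i f v) -/v2 -(act_teN i j e v2) -/v3 -!actM.
  congr act; rewrite teN -(mulgA (te i j e)^-g) E.
  by rewrite !mulgA mulVg mul1g.
by rewrite !mulgA -(mulgA _ _ (te k i f)) -E; apply: same_coset_refl.
Qed.

(** Both reductions are possible only if |v_i| = |v_j|; the reduced vectors then differ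
    by the signed permutation w_ij. *)
Lemma peak_swap i j e f : i \in A -> j \in A -> i != j ->
  down (sg e (v j 0)) (v i 0) -> down (sg f (v i 0)) (v j 0) -> peak v i j e j i f.
Proof.
move=> iA jA ij d1 d2; have ji : j != i by rewrite eq_sym.
have [ef vij] := down_swap d1 d2; rewrite ef in d2 *.
set v1 := act (te i j (~~ e)) v.
have v1i : v1 i 0 = 0 by rewrite /v1 (act_te_at _ _ ij) vij sgN subrr.
have [||x Rx] := @over_total v1 A_gt1; [exact: act_neq0|exact: supp_te|].
have R1 := over_fix e ji jA iA v1i Rx.
have fix1 : act (te j i e) v1 = v1.
  by rewrite act_te // v1i; case: (e); rewrite /= ?oppr0 scale0r addr0.
exists x, (w i j e *g (te j i e *g x)); split => //.
  have -> : act (te j i (~~ e)) v = act (w i j e) v1.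
    rewrite -[in LHS](act_teN i j e v) -/v1 (te_w e ij) !actM fix1.
    by rewrite teN actK.
  exact: over_weyl.
by rewrite (te_w e ij) -!mulgA; apply: same_coset_refl.
Qed.

Hypothesis IH : forall u, (norm u < norm v)%N ->
  forall x y, over u x -> over u y -> same_coset x y.

Lemma peak_trans i j e k l f i' j' e' : k != l -> down (sg f (v l 0)) (v k 0) ->
  peak v i j e k l f -> peak v k l f i' j' e' -> peak v i j e i' j' e'.
Proof.
move=> kl d [x [y [Rx Ry xy]]] [y' [x' [Ry' Rx' y'x']]].
exists x, x'; split=> //; apply: same_coset_trans xy _; apply: same_coset_trans y'x'.
by apply: same_coset_mull; apply: IH Ry Ry'; apply: norm_down.
Qed.

(** Subtracting v_j and v_l from the same coordinate might change its sign. Instead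
    compare both reductions with the reduction of the larger of v_j, v_l by the smaller
    one, which meets them in a chain and in a commuting peak. *)
Lemma peak_row i j e l f : i \in A -> j \in A -> l \in A ->
  i != j -> i != l -> j != l ->
  down (sg e (v j 0)) (v i 0) -> down (sg f (v l 0)) (v i 0) -> peak v i j e i l f.
Proof.
move=> iA jA lA ij il jl d1 d2.
wlog le : j l e f jA lA ij il jl d1 d2 / `|v l 0| <= `|v j 0|.
  move=> H; case: (leP `|v l 0| `|v j 0|) => [|/ltW] le; first exact: H.
  by apply/peak_sym/H => //; rewrite eq_sym.
have ji : j != i by rewrite eq_sym.
have li : l != i by rewrite eq_sym.
have d := down_row d1 d2 le.
(* The common comparison is the reduction of v_j by v_l. *)
have P1 : peak v i j e j l (e (+) f) by apply: peak_sym; apply: peak_chain.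
have P2 : peak v j l (e (+) f) i l f by apply: peak_commute.
exact: peak_trans jl d P1 P2.
Qed.

Lemma peak_all i j e k l f : i \in A -> j \in A -> k \in A -> l \in A ->
  i != j -> k != l ->
  down (sg e (v j 0)) (v i 0) -> down (sg f (v l 0)) (v k 0) -> peak v i j e k l f.
Proof.
move=> iA jA kA lA ij kl d1 d2.
have [ik|ik] := eqVneq i k.
  move: kl d2; rewrite -ik => il d2; have [jl|jl] := eqVneq j l; last exact: peak_row.
  move: il d2; rewrite -jl => _ d2.
  rewrite -(down_sign d1 d2).
  have [||x Rx] := @over_total (act (te i j (~~ e)) v) A_gt1.
  - exact: act_neq0.
  - exact: supp_te.
  by exists x, x; split=> //; apply: same_coset_refl.
have [il|il] := eqVneq i l.
  move: kl d2; rewrite -il => ki d2; have [jk|jk] := eqVneq j k; last exact: peak_chain.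
  by move: d2; rewrite -jk => d2; apply: peak_swap.
have [jk|jk] := eqVneq j k; last exact: peak_commute.
move: kl d2; rewrite -jk => jl d2; apply: peak_sym; apply: peak_chain => //.
by rewrite eq_sym.
Qed.

End Peaks.

Lemma card_gt1 i j : i != j -> i \in A -> j \in A -> (1 < #|A|)%N.
Proof. by move=> ij iA jA; apply/card_gt1P; exists i, j. Qed.

(** A vector with a single nonzero coordinate cannot be reduced. *)
Lemma weylA_not_down v m y i j e : i != j -> weylA y -> v = m *: act y (delta_mx z 0) ->
  ~~ down (sg e (v j 0)) (v i 0).
Proof.
move=> ij /weylA_basis[a _ ya] ->; have mE k : (m *: act y (delta_mx z 0)) k 0 = m * act y (delta_mx z 0) k 0 by rewrite mxE.
rewrite !mE; apply/negP.
have [ia|/ya ->] := eqVneq i a.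
  have /ya -> : j != a by rewrite -ia eq_sym.
  by rewrite mulr0 /down; case: (e) => /=; lia.
by rewrite mulr0 /down; case: (e) => /=; lia.
Qed.

(** Diamond lemma: by induction on the norm, it is enough to resolve the peaks. *)
Lemma over_uniq v x y : over v x -> over v y -> same_coset x y.
Proof.
elim/norm_ind: v => v IH in x y *; move=> Rx Ry.
have v0 := over_neq0 Rx; have vA := over_supp Rx.
case: Rx => [m x' h m0 Wx Hh Ev Ex|i j e x' ij iA jA d Rx ->];
case: Ry => [m' y' h' m0' Wy Hh' Ev' Ey|k l f y' kl kA lA d' Ry Ey].
- rewrite Ex Ey /same_coset invgM -mulgA (mulgA x'^-g); apply/stabM/stabM => //; first exact: stabV.
  apply: (weylA_stab m0 m0'); first by apply: gen_mul => //; apply: weylAV.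
  by rewrite actM (actZ y') -Ev' Ev actZ actK.
- by have := weylA_not_down f kl Wx Ev; rewrite d'.
- by have := weylA_not_down e ij Wy Ev'; rewrite d.
have [x1 [y1 [R1 R2 E]]] := peak_all (card_gt1 ij iA jA) v0 vA IH iA jA kA lA ij kl d d'.
rewrite Ey; apply: same_coset_trans (same_coset_mull _ (IH _ (norm_down ij d) _ _ Rx R1)) _.
apply: same_coset_trans E (same_coset_mull _ (IH _ (norm_down kl d') _ _ R2 Ry)).
Qed.

(** By totality the reduced vector has some coset, by uniqueness it is the expected one.
    *)
Lemma over_reduce v x i j e : i != j -> i \in A -> j \in A ->
  sg e (v j 0) * v i 0 <= 0 -> `|v j 0| <= `|v i 0| ->
  over v x -> over (act (te i j e) v) (te i j e *g x).
Proof.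
move=> ij iA jA neg le Rx; have ji : j != i by rewrite eq_sym.
have [||y Ry] := @over_total (act (te i j e) v) (card_gt1 ij iA jA).
- exact/act_neq0/over_neq0/Rx.
- exact/supp_te/over_supp/Rx.
apply: over_same_coset (Ry).
have Rv : over v (te i j (~~ e) *g y).
  have <- : act (te i j (~~ e)) (act (te i j e) v) = v by rewrite teN actK.
  apply: over_up => //; rewrite act_te_at // act_te_off //; move: neg le.
  by case: (e) => /=; nia.
have := same_coset_mull (te i j e) (over_uniq Rv Rx).
by rewrite teN mulVKg.
Qed.

(** If v_i and the change of v_i have opposite signs and |v_j| > |v_i|, then t_ij is
    neither a reduction nor the inverse of one. In t_ji w_ij t_ji the first factor to
    act is a reduction and the last one the inverse of a reduction. *)
Lemma over_te v x i j e : i != j -> i \in A -> j \in A ->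
  over v x -> over (act (te i j e) v) (te i j e *g x).
Proof.
move=> ij iA jA Rx; have ji : j != i by rewrite eq_sym.
have [up|/ltW neg] := leP 0 (sg e (v j 0) * v i 0); first exact: over_up.
have [le|/ltW ge] := leP `|v j 0| `|v i 0|; first exact: over_reduce.
(* Now |v_j| > |v_i| and v_i changes sign. *)
rewrite (te_w e ij) actM actM -mulgA -(mulgA (te j i e)); set v1 := act (te j i e) v.
have R1 : over v1 (te j i e *g x).
  by apply: over_reduce => //; move: neg; case: (e) => /=; nia.
apply: over_up => //; last exact: over_weyl.
rewrite act_w_fst // act_w_snd // (act_te_at _ _ ji) (act_te_off _ _ ji ij).
by move: neg ge; case: (e) => /=; nia.
Qed.

(** Both 1 and x lie over e_z. *)
Lemma stabilizer x : full A x ->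
  act x (delta_mx z 0) = delta_mx z 0 -> stab x.
Proof.
move=> Gx fixz; have R1 : over (delta_mx z 0) 1g.
  apply: (@over_base _ _ 1 1g 1g); rewrite ?act1 ?mulg1 ?scale1r //; first exact: gen1.
  exact: stab1.
suff Rx : over (act x (delta_mx z 0)) x.
  by rewrite fixz in Rx; have := over_uniq R1 Rx; rewrite /same_coset invg1 mul1g.
elim: Gx => [|s g [i [j [e [ij /= /andP[iA jA] ->]]]] _ IH]; first by rewrite act1.
by rewrite actM; apply: over_te.
Qed.

Lemma weylA_sub x : weylA x -> full A x.
Proof.
elim=> [|s g [i [j [e [ij iA jA ->]]]] _ IH]; first exact: gen1.
have L a b f : a != b -> a \in A -> b \in A ->
    full A (te a b f).
  by move=> ab aA bA; apply: gen_in; exists a, b, f; split=> //=; rewrite aA.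
by apply: gen_mul => //; rewrite /w; do !apply: gen_mul; apply: L => //; rewrite eq_sym.
Qed.

Lemma stab_sub x : stab x -> full A x.
Proof.
apply: gen_sub => s [i [j [e [ij /and3P[iA jA _] ->]]]].
by exists i, j, e; split=> //=; rewrite iA.
Qed.

(** Needed so that reducing a column of a matrix leaves the rows and columns outside A
    alone. *)
Lemma over_sub v x : over v x -> full A x.
Proof.
elim=> {v x} [v x m y h m0 /weylA_sub Wy /stab_sub Hh _ ->|v x i j e y ij iA jA _ _ IH ->].
  exact: gen_mul.
by apply: genM => //; exists i, j, e; split=> //=; rewrite iA.
Qed.

End Stabilizer.

(** * Injectivity and surjectivity *)

Lemma full_fix_row A x v i : full A x -> i \notin A -> act x v i 0 = v i 0.
Proof.
move=> Ax iA; elim: Ax => [|s g [k [l [e [kl /= /andP[kA lA] ->]]]] _ IH].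
  by rewrite act1.
by rewrite actM act_te_off //; apply: contraNneq iA => ->.
Qed.

Lemma full_fix_col A x j : full A x -> j \notin A -> act x (delta_mx j 0) = delta_mx j 0.
Proof.
move=> Ax jA; elim: Ax => [|s g [k [l [e [kl /= /andP[kA lA] ->]]]] _ IH].
  by rewrite act1.
have lj : l != j by apply: contraNneq jA => <-.
by rewrite actM IH act_te // !mxE (negbTE lj); case: (e); rewrite /= ?oppr0 scale0r addr0.
Qed.

Lemma fullV A x : full A x -> full A x^-g.
Proof. by apply: gen_inv; apply: letterV. Qed.

(** The letters in row z generate an abelian subgroup, whose elements act as shears in
    the direction e_z. *)
Definition rowz (z : 'I_n) (B : {set 'I_n}) := gen (letter [rel i j | (i == z) && (j \in B)]).

Implicit Types (A B : {set 'I_n}) (e f : bool).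

(** The shears are normalized by the letters on the remaining indices. *)
Lemma rowz_te z B i j e (u : G) : z \notin B -> i \in B -> j \in B -> i != j -> rowz z B u ->
  exists2 u' : G, rowz z B u' & te i j e *g u = u' *g te i j e.
Proof.
move=> zB iB jB ij; elim=> [|s g [z' [m [f [zm /= /andP[/eqP z'z mB] ->]]]] _ [u' Uu' IH]].
  by exists 1g; [exact: gen1|rewrite mulg1 mul1g].
rewrite {z'}z'z in zm *.
have jz : j != z by apply: contraNneq zB => <-.
have zi : z != i by apply: contraNneq zB => ->.
have zj : z != j by rewrite eq_sym.
have Uz k a : k \in B -> rowz z B (te z k a).
  move=> kB; apply: gen_in; exists z, k, a; split=> //=; last by rewrite eqxx.
  by apply: contraNneq zB => ->.
have [im|im] := eqVneq i m; last first.
  exists (te z m f *g u'); first by apply: gen_mul => //; apply: Uz.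
  rewrite mulgA (_ : te i j e *g te z m f = te z m f *g te i j e); last exact: teC.
  by rewrite -mulgA IH mulgA.
exists (te z m f *g te z j (~~ (f (+) e)) *g u').
  by do 2 (apply: gen_mul => //); apply: Uz.
have E : te i j e *g te z m f = te z m f *g te z j (~~ (f (+) e)) *g te i j e.
  have C : te z j (~~ (f (+) e)) *g te i j e = te i j e *g te z j (~~ (f (+) e)).
    by apply: teC => //; rewrite eq_sym.
  by rewrite -im -mulgA C mulgA te_swapS // -mulgA teN mulgV mulg1.
by rewrite mulgA E -mulgA IH mulgA.
Qed.

(** The stabilizer is the product of the normal subgroup of shears and of the subgroup
    on the remaining indices. *)
Lemma stab_split A z x : stab A z x ->
  exists (u y : G), [/\ rowz z (A :\ z) u, full (A :\ z) y & x = u *g y].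
Proof.
elim=> [|s g [i [j [e [ij /and3P[iA jA jz] ->]]]] _ [u [y [Uu Ay ->]]]].
  by exists 1g, 1g; split; [exact: gen1|exact: gen1|rewrite mul1g].
have [iz|iz] := eqVneq i z.
  exists (te i j e *g u), y; split; rewrite ?mulgA //.
  by apply: genM => //; exists i, j, e; split=> //; rewrite /= iz eqxx !inE jz.
have [|||u' Uu' E] := @rowz_te z (A :\ z) i j e u _ _ _ ij Uu; rewrite ?inE ?iz ?jz ?eqxx //.
exists u', (te i j e *g y); split; rewrite ?mulgA ?E //.
by apply: genM => //; exists i, j, e; split=> //; rewrite /= !inE iz jz iA.
Qed.

Lemma act_te_exp i j e m v : i != j ->
  act (te i j e ^+g m) v = v + sg e (v j 0) *+ m *: delta_mx i 0.
Proof.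
move=> ij; elim: m => [|m IH]; first by rewrite expg0 act1 scale0r addr0.
rewrite expgS actM IH act_te // !mxE [j == i]eq_sym (negbTE ij) mulr0 addr0.
by rewrite mulrSr scalerDl addrA.
Qed.

(** In the abelian group of shears, the powers of a single letter are collected in
    front. *)
Lemma rowz_pop z B b (u : G) : z != b -> z \notin B -> rowz z B u ->
  exists e m (u' : G), rowz z (B :\ b) u' /\ u = (te z b e ^+g m) *g u'.
Proof.
move=> zb zB; elim=> [|s g [z' [j [f [zj /= /andP[/eqP z'z jB] ->]]]] _ [e [m [u' [Uu' ->]]]]].
  by exists false, 0%N, 1g; split; [exact: gen1|rewrite expg0 mul1g].
rewrite {z'}z'z in zj *.
have [jb|jb] := eqVneq j b.
  have [fe|fe] := eqVneq f e.
    by exists e, m.+1, u'; split=> //; rewrite jb fe mulgA -expgS.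
  have {}fe : f = ~~ e by case: (f) (e) fe => [] [].
  (* A letter of the opposite sign cancels one factor of the power, or starts a power of that sign. *)
  case: m => [|m].
    by exists f, 1%N, u'; split=> //; rewrite jb expg0 expg1 mul1g.
  by exists e, m, u'; split=> //; rewrite jb fe expgS teN -mulgA mulKg.
exists e, m, (te z j f *g u'); split.
  by apply: genM => //; exists z, j, f; split=> //; rewrite /= eqxx !inE jb.
rewrite !mulgA; congr (_ *g _); apply: commuteX.
by apply: teC => //; rewrite eq_sym.
Qed.

(** The exponent of each letter of a shear is an entry of row z of its matrix. *)
Lemma rowz_inj z B (u : G) : z \notin B -> rowz z B u ->
  (forall v, act u v z 0 = v z 0) -> u = 1g.
Proof.
have [N] := ubnP #|B|; elim: N => // N IH in B u *; rewrite ltnS => BN zB Uu fixz.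
have [B0|[b bB]] := set_0Vmem B.
  by elim: Uu => // s g [i [j [e []]]]; rewrite /= B0 inE andbF.
have zb : z != b by apply: contraNneq zB => ->.
have [e [m [u' [Uu' E]]]] := rowz_pop zb zB Uu.
have zB' : z \notin B :\ b by rewrite !inE (negbTE zB) andbF.
have fixb : act u' (delta_mx b 0) = delta_mx b 0.
  elim: Uu' => [|s g [i [j [f [ij /= /andP[_ jB] ->]]]] _ IHu]; first exact: act1.
  rewrite actM IHu act_te // !mxE; move: jB; rewrite !inE => /andP[/negbTE -> _].
  by case: (f); rewrite /= ?oppr0 scale0r addr0.
have m0 : m = 0%N.
  have := fixz (delta_mx b 0); rewrite E actM fixb act_te_exp // !mxE !eqxx (negbTE zb) /=.
  by case: (e) => /=; lia.
rewrite m0 expg0 mul1g in E.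
rewrite E; apply: IH (Uu') _ => //; last by rewrite -E.
by move: BN; rewrite (cardsD1 b) bB.
Qed.

(** Peel off one index at a time: the kernel is contained in the stabilizer of e_z,
    hence in the shears times the group on the remaining indices, and row z of the
    matrix determines the shear. *)
Lemma phi_inj_full A x : full A x -> phi x = 1%g -> x = 1g.
Proof.
have [N] := ubnP #|A|; elim: N => // N IH in A x *; rewrite ltnS => AN Ax phix.
have actx v : act x v = v by rewrite /act phix mul1mx.
have [A0|[z zA]] := set_0Vmem A.
  by elim: Ax {phix actx} => // s g [i [j [e []]]]; rewrite /= A0 inE.
have [u [y [Uu Ay Exuy]]] := stab_split (stabilizer zA Ax (actx _)).
have zA' : z \notin A :\ z by rewrite !inE eqxx.
have u1 : u = 1g.
  apply: rowz_inj Uu _ => // v.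
  by rewrite -{1}(actVK y v) -actM -Exuy actx (full_fix_row _ (fullV Ay)).
rewrite u1 mul1g in Exuy.
rewrite Exuy; apply: IH (Ay) _; last by rewrite -Exuy.
by move: AN; rewrite (cardsD1 z) zA.
Qed.

Lemma shear_exists z (s : seq 'I_n) (q : 'I_n -> int) : z \notin s ->
  exists u : G, forall v, act u v = v + (\sum_(j <- s) q j * v j 0) *: delta_mx z 0.
Proof.
elim: s => [|b s IH]; first by exists 1g => v; rewrite big_nil scale0r addr0 act1.
rewrite inE negb_or => /andP[zb /IH[u Hu]].
exists ((te z b (q b < 0) ^+g `|q b|%N) *g u) => v.
rewrite actM act_te_exp // Hu !mxE [b == z]eq_sym (negbTE zb) mulr0 addr0 big_cons.
rewrite -addrA -scalerDl [X in X *: _]addrC; congr (_ + (_ + _) *: _).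
by case: ltP => /=; nia.
Qed.

(** Used to show that the reduced form m e_z of a column of a unimodular matrix has m =
    1. *)
Lemma det_col_scaled (M : 'M[int]_n) z m :
  (forall i, M i z = m * (i == z)%:R) -> exists c, \det M = m * c.
Proof.
move=> Mz; exists (cofactor M z z); rewrite (expand_det_col _ z) (bigD1 z) //= big1.
  by rewrite addr0 Mz eqxx mulr1.
by move=> i iz; rewrite Mz (negbTE iz) mulr0 mul0r.
Qed.

Lemma mul_delta (M : 'M[int]_n) i j : (M *m (delta_mx j 0 : 'cV[int]_n)) i 0 = M i j.
Proof. by rewrite -colE mxE. Qed.

(** Reduce column z to e_z by left multiplication, clear row z by a shear on the right,
    and continue with the matrix on the remaining indices. *)
Lemma phi_surj_full A (M : SL int n) :
  (forall i j, (i \notin A) || (j \notin A) -> M i j = (i == j)%:R) -> exists x, phi x = M.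
Proof.
have [N] := ubnP #|A|; elim: N => // N IH in A M *; rewrite ltnS => AN idM.
have [A1|A_gt1] := leqP #|A| 1.
  exists 1g; rewrite gmulf1; apply: val_inj => /=; apply/matrixP => i j.
  have off a b : a != b -> M a b = 0.
    move=> ab; rewrite idM ?(negbTE ab) //; apply: contraTT A1.
    by rewrite negb_or !negbK -ltnNge => /andP[aA bA]; apply/card_gt1P; exists a, b.
  rewrite mxE; have [<-|ij] := eqVneq i j; last by rewrite off.
  have [iA|iA] := boolP (i \in A); last by rewrite idM ?iA // eqxx.
  have := sl_det M; rewrite det_trig; last first.
    by apply/is_trig_mxP => a b ab; apply: off; rewrite -(inj_eq val_inj) ltn_eqF.
  rewrite (bigD1 i) //= big1 ?mulr1 // => k ki; rewrite idM ?eqxx //.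
  rewrite orbb; apply: contraTN A1 => kA.
  by rewrite -ltnNge; apply/card_gt1P; exists k, i.
have [z zA] : exists z, z \in A by apply/card_gt0P/ltnW.
pose v : 'cV[int]_n := (M : 'M[int]_n) *m delta_mx z 0.
have v0 : v <> 0.
  move=> /(congr1 (mulmx (invmx M))); rewrite mulKmx ?sl_unit // mulmx0 => /colP/(_ z).
  by rewrite !mxE !eqxx.
have vA : supp A v by move=> k kA; rewrite /v mul_delta idM ?kA //; case: eqP kA zA => // -> /negbTE->.
have [x Rx] := over_total zA A_gt1 v0 vA.
have Ax := over_sub Rx; have [m m0 Ev] := over_act Rx.
pose M1 : SL int n := (phi x^-g * M)%g.
have actM1 u : (M1 : 'M[int]_n) *m u = act x^-g ((M : 'M[int]_n) *m u).
  by rewrite /M1 /= -mulmxA.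
have M1z i : M1 i z = m * (i == z)%:R.
  by rewrite -mul_delta actM1 -/v Ev actZ actK !mxE eqxx andbT.
have m1 : m = 1.
  (* m divides the determinant and is positive. *)
  have [c] := det_col_scaled M1z; rewrite sl_det => mc; have c0 : 0 < c by rewrite -(pmulr_rgt0 c m0) -mc.
  by nia.
have idM1 i j : (i \notin A) || (j \notin A) -> M1 i j = (i == j)%:R.
  move=> ijA; have [jA|jA] := boolP (j \in A); last first.
    rewrite -mul_delta actM1 (_ : _ *m _ = delta_mx j 0).
      by rewrite (full_fix_col (fullV Ax) jA) mxE eqxx andbT.
    by apply/colP => k; rewrite mul_delta idM ?jA ?orbT // mxE eqxx andbT.
  have iA : i \notin A by move: ijA; rewrite jA orbF.
  by rewrite -mul_delta actM1 (full_fix_row _ (fullV Ax) iA) mul_delta idM.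
pose q j := - M1 z j.
have zs : z \notin enum (A :\ z) by rewrite mem_enum !inE eqxx.
have [u Hu] := shear_exists q zs.
pose M2 : SL int n := (M1 * phi u)%g.
have M2E i j : M2 i j = M1 i j + (j \in A :\ z)%:R * q j * (i == z)%:R.
  have E : (M2 : 'M[int]_n) *m delta_mx j 0 = (M1 : 'M[int]_n) *m act u (delta_mx j 0).
    by rewrite /M2 /act mulmxA.
  rewrite -mul_delta E Hu mulmxDr -scalemxAr mxE mul_delta.
  rewrite [in X in _ + X]mxE mul_delta M1z m1 mul1r; congr (_ + _ * _).
  rewrite big_enum /=; have [jB|jB] := boolP (j \in A :\ z).
    rewrite (bigD1 j) //= big1 ?addr0 => [|k /andP[_ kj]].
      by rewrite !mxE !eqxx mulr1 mul1r.
    by rewrite !mxE (negbTE kj) mulr0.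
  rewrite mul0r big1 // => k kB; rewrite !mxE; case: eqP kB jB => [->->//|]; by rewrite mulr0.
have [||y Hy] := IH (A :\ z) M2.
- by move: AN; rewrite (cardsD1 z) zA.
- move=> i j; rewrite M2E !inE !negb_and !negbK => H.
  have [iz|iz] := eqVneq i z.
    rewrite mulr1 /q iz; have [->|jz] := eqVneq j z; first by rewrite M1z m1 !eqxx mul0r addr0.
    have [jA|jA] := boolP (j \in A); first by rewrite mul1r subrr.
    by rewrite mul0r addr0 idM1 ?jA ?orbT // eq_sym (negbTE jz).
  rewrite mulr0 addr0; have [->|jz] := eqVneq j z; first by rewrite M1z m1 mul1r.
  by apply: idM1; move: H; rewrite (negbTE iz) (negbTE jz).
exists (x *g y *g u^-g); rewrite !gmulfM Hy gmulfV /M2 /M1 gmulfV.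
by rewrite !mulgA mulgV mul1g mulgK.
Qed.

End SteinbergCalculus.

(** * The words tau evaluated at the matrices *)

Section MatrixGenerators.
Local Open Scope ring_scope.
Variable n : nat.
Local Notation E := (E n).
Local Notation SLn := (SL int n).
Local Notation "M *g N" := (@monoid.mul SLn M N) (at level 40, left associativity).

Lemma E_mul i j k l : idx n j -> E i j * E k l = if j == k then E i l else 0.
Proof.
case: j => [//|j] /= jn; pose oj : 'I_n := Ordinal jn.
apply/matrixP => r c; rewrite mxE (bigD1 oj) //= big1 => [|s sj]; last first.
  rewrite !mxE eqSS -(inj_eq val_inj) in sj *.
  by rewrite (negbTE sj) andbF mul0r.
rewrite !mxE /= eqxx andbT addr0; case: (j.+1 == k); rewrite !mxE /= ?mulr0 //.
by case: (r.+1 == i); rewrite ?mul1r ?mul0r.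
Qed.

Lemma scaleAl c (A B : 'M[int]_n) : c *: A * B = c *: (A * B).
Proof. exact/esym/scalemxAl. Qed.

Lemma scaleAr c (A B : 'M[int]_n) : A * (c *: B) = c *: (A * B).
Proof. exact/esym/scalemxAr. Qed.

Lemma sl_eqP (A B : SLn) : (A : 'M[int]_n) = B -> A = B.
Proof. exact: val_inj. Qed.

Lemma det_elementary c i j : i != j -> \det (1 + c *: E i j : 'M[int]_n) == 1.
Proof.
have lower a b : (b < a)%N -> \det (1 + c *: E a b : 'M[int]_n) == 1.
  move=> ba; rewrite det_trig; last first.
    apply/is_trig_mxP => r s rs; rewrite !mxE -(inj_eq val_inj) (ltn_eqF rs) add0r.
    by case: eqP => [ra|]; rewrite ?mulr0 //=; case: eqP => [sb|]; rewrite ?mulr0 //; lia.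
  rewrite big1 // => r _; rewrite !mxE eqxx.
  by case: eqP => [ra|]; rewrite ?mulr0 //=; case: eqP => [sb|]; rewrite ?mulr0 //; lia.
rewrite neq_ltn => /orP[ij|]; last exact: lower.
rewrite -det_tr linearD linearZ /= -[X in X + _]/(1%:M^T) trmx1.
suff -> : (E i j)^T = E j i by apply: lower.
by apply/matrixP => r s; rewrite !mxE andbC.
Qed.

Lemma sl_commg (A B C : SLn) : A *g B = B *g A *g C -> [~ A, B]%g = C.
Proof. by move=> e; apply: (mulgI (B *g A)); rewrite -e -commgC. Qed.

Lemma sl_mulE (A B : SLn) : (A *g B : 'M[int]_n) = (A : 'M[int]_n) * B.
Proof. by []. Qed.

Lemma sl_oneE : ((1%g : SLn) : 'M[int]_n) = 1.
Proof. by []. Qed.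

Definition elementary (A : SLn) c i j := (A : 'M[int]_n) = 1 + c *: E i j.

(** The Steinberg commutator formula: with U = E_ij and V = E_jk, only UV = E_ik
    survives in (1 + U)(1 + V) = (1 + V)(1 + U)(1 + UV). *)
Lemma elementary_commg A B i j k : idx n i -> idx n j -> idx n k ->
  i != j -> j != k -> i != k -> elementary A 1 i j -> elementary B 1 j k ->
  elementary [~ A, B]%g 1 i k.
Proof.
move=> ii ij ik nij njk nik eA eB.
have -> : [~ A, B]%g = MkSL (det_elementary 1 nik); last by [].
apply/sl_commg/sl_eqP; rewrite !sl_mulE eA eB /= !scale1r.
rewrite !(mulrDl, mulrDr, mul1r, mulr1) !E_mul //.
rewrite !eqxx [j == i]eq_sym [k == i]eq_sym (negbTE nij) (negbTE nik).
by rewrite !(addr0, mul0r) !addrA [1 + E j k + _]addrAC.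
Qed.

Lemma elementary_commute A B i j k l : elementary A 1 i j -> elementary B 1 k l ->
  idx n j -> idx n l -> j != k -> i != l -> [~ A, B]%g = 1%g.
Proof.
rewrite /elementary => eA eB ij il njk nil.
apply/sl_commg/sl_eqP; rewrite !sl_mulE eA eB sl_oneE mulr1 !scale1r.
rewrite !(mulrDl, mulrDr, mul1r, mulr1) !E_mul // (negbTE njk) [l == i]eq_sym (negbTE nil).
by rewrite !addr0 addrAC.
Qed.

Lemma elementary_inv A c i j : idx n j -> i != j -> elementary A c i j ->
  elementary A^-1%g (- c) i j.
Proof.
move=> jn ij eA; rewrite /elementary.
have dB := det_elementary (- c) ij.
have -> : A^-1%g = MkSL dB.
  apply: mulg1_eq; apply: sl_eqP; rewrite sl_mulE eA /=.
  rewrite scaleNr mulrDl !mulrBr !mul1r !mulr1 scaleAl scaleAr E_mul //.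
  by rewrite [j == i]eq_sym (negbTE ij) !scaler0 subr0 subrK.
by [].
Qed.

Lemma E_mul_a i j : (0 < j < n)%N -> E i j * a_mx n = E i j.+1.
Proof.
move=> /andP[j0 jn]; rewrite /a_mx mulrDr mulr_sumr scaleAr E_mul; last by rewrite /idx; lia.
rewrite [j == n]ltn_eqF // scaler0 addr0 (bigD1_seq j) ?iota_uniq ?mem_index_iota ?j0 //=.
rewrite E_mul ?eqxx; last by rewrite /idx; lia.
rewrite big1 ?addr0 // => k kj; rewrite E_mul; last by rewrite /idx; lia.
by rewrite eq_sym (negbTE kj).
Qed.

Lemma a_mul_E i j : (0 < i < n)%N -> a_mx n * E i.+1 j = E i j.
Proof.
move=> /andP[i0 iltn]; rewrite /a_mx mulrDl mulr_suml scaleAl E_mul; last by rewrite /idx; lia.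
rewrite eqSS [0 == i]ltn_eqF // scaler0 addr0.
rewrite (bigD1_seq i) ?iota_uniq ?mem_index_iota ?i0 //=.
rewrite E_mul ?eqxx /idx ?iltn //; rewrite big_nat_cond big1 ?addr0 // => k /andP[/andP[k0 kn] ki].
by rewrite E_mul /idx // eqSS (negbTE ki).
Qed.

Lemma a_mul_E1 j : (0 < n)%N -> a_mx n * E 1 j = (-1) ^+ n.-1 *: E n j.
Proof.
move=> n0; rewrite /a_mx mulrDl mulr_suml scaleAl E_mul /idx //.
rewrite big_nat big1 ?add0r // => k /andP[k0 kn]; rewrite E_mul /idx ?kn //.
by rewrite eqSS gtn_eqF.
Qed.

Local Notation tau := (tau n (a_ n) (b_ n)).
Hypothesis n_gt2 : (2 < n)%N.

Lemma conj_a (A B : SLn) : (A : 'M[int]_n) * a_mx n = a_mx n * B ->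
  ((a_ n)^-1 * A * a_ n)%g = B.
Proof.
by move=> e; apply: (mulgI (a_ n)); rewrite -!mulgA mulVKg; apply: sl_eqP; rewrite !sl_mulE e.
Qed.

(** Conjugation by a_n shifts both indices of a matrix unit by one, since a_n is a
    permutation matrix up to the sign in its last row. *)
Lemma tau_subE r : (0 < r < n)%N -> elementary (tau_sub (a_ n) (b_ n) r) 1 r.+1 r.
Proof.
case: r => [//|r] /= rn; elim: r rn => [|r IH] rn.
  by rewrite /elementary /tau_sub expg0 invg1 mul1g mulg1 scale1r.
have {}IH := IH (ltnW rn); rewrite /elementary.
pose B := tau_sub (a_ n) (b_ n) r.+1.
have -> : tau_sub (a_ n) (b_ n) r.+2 = ((a_ n)^-1 * B * a_ n)%g.
  by rewrite /B /tau_sub /= expgSr invgM !mulgA.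
have E1 : (B : 'M[int]_n) * a_mx n = a_mx n * (1 + 1 *: E r.+3 r.+2).
  rewrite IH !scale1r [LHS]mulrDl [RHS]mulrDr mul1r mulr1 E_mul_a ?a_mul_E //; lia.
have dB : \det (1 + 1 *: E r.+3 r.+2 : 'M[int]_n) == 1 by apply: det_elementary; lia.
by rewrite (@conj_a B (MkSL dB)).
Qed.

(** The last shift wraps around and picks up the sign eps_n, which the exponent in the
    definition of tau_1n removes. *)
Lemma tau_1nE : elementary (tau_1n n (a_ n) (b_ n)) 1 1 n.
Proof.
have eps2 : (-1) ^+ n.-1 * (-1) ^+ n.-1 = 1 :> int by rewrite -expr2 sqrr_sign.
pose B := tau_sub (a_ n) (b_ n) n.-1.
have eB : elementary B 1 n n.-1.
  by have := @tau_subE n.-1; rewrite prednK; [apply; lia|lia].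
have ET : ((a_ n) ^- n.-1 * b_ n * (a_ n) ^+ n.-1 = (a_ n)^-1 * B * a_ n)%g.
  rewrite /B /tau_sub -[in LHS](@prednK n.-1) ?expgSr ?invgM ?mulgA //; lia.
have E1 : (B : 'M[int]_n) * a_mx n = a_mx n * (1 + (-1) ^+ n.-1 *: E 1 n).
  rewrite eB scale1r [LHS]mulrDl [RHS]mulrDr mul1r mulr1 E_mul_a; last lia.
  by rewrite prednK ?(ltnW (ltnW n_gt2)) // scaleAr a_mul_E1 ?scalerA ?eps2 ?scale1r //; lia.
have dB : \det (1 + (-1) ^+ n.-1 *: E 1 n : 'M[int]_n) == 1 by apply: det_elementary; lia.
have eT : elementary ((a_ n) ^- n.-1 * b_ n * (a_ n) ^+ n.-1)%g ((-1) ^+ n.-1) 1 n.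
  by rewrite /elementary ET (conj_a (B := MkSL dB) E1).
have sgn : (-1) ^+ n.-1 = (if odd n then 1 else -1) :> int.
  by rewrite -signr_odd; case: n n_gt2 => // m _ /=; case: (odd m).
rewrite /tau_1n; move: eT; rewrite sgn; case: (odd n) => // eT.
rewrite -[1]opprK; apply: elementary_inv eT; rewrite /idx; lia.
Qed.

Lemma tau_diagE d j : (0 < j)%N -> (d.+1 + j <= n)%N ->
  elementary (tau_diag (a_ n) (b_ n) d j) 1 (d.+1 + j) j.
Proof.
elim: d j => [|d IH] j j0 dj; first by apply: tau_subE; lia.
have eA := IH j.+1 (ltn0Sn j); rewrite addnS in eA.
have eB : elementary (tau_sub (a_ n) (b_ n) j) 1 j.+1 j by apply: tau_subE; lia.
by apply: (elementary_commg (j := j.+1)) eB; rewrite /idx; try lia; apply: eA; lia.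
Qed.

Lemma tau_lowE i j : (0 < j < i)%N -> (i <= n)%N ->
  elementary (tau_low (a_ n) (b_ n) i j) 1 i j.
Proof.
move=> /andP[j0 ji] iltn; have := @tau_diagE (i - j).-1 j j0.
by rewrite prednK ?subn_gt0 // (subnK (ltnW ji)); apply.
Qed.

Lemma tau_lastE i : (0 < i < n)%N -> elementary (tau_last n (a_ n) (b_ n) i) 1 i n.
Proof.
move=> /andP[i0 iltn]; rewrite /tau_last; have [->|i1] := eqVneq i 1%N; first exact: tau_1nE.
apply: (elementary_commg (j := 1%N)) tau_1nE; rewrite /idx; try lia.
by apply: tau_lowE; lia.
Qed.

Lemma tauE i j : idx n i -> idx n j -> i != j -> elementary (tau i j) 1 i j.
Proof.
rewrite /idx /Defs.tau => ii ij nij; case: ifP => [ji|ji]; first by apply: tau_lowE; lia.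
have [->|jn] := eqVneq j n; first by apply: tau_lastE; lia.
apply: (elementary_commg (j := n)); rewrite /idx; try lia.
  by apply: tau_lastE; lia.
by apply: tau_lowE; lia.
Qed.

Lemma weylE i : (0 < i < n)%N ->
  (weyl n (a_ n) (b_ n) i : 'M[int]_n) = 1 - E i i - E i.+1 i.+1 + E i i.+1 - E i.+1 i.
Proof.
move=> i_n; have [i_i i_i1] : idx n i /\ idx n i.+1 by rewrite /idx; lia.
have ne : i != i.+1 by rewrite neq_ltn ltnSn.
have eU := tauE i_i i_i1 ne.
have eL := elementary_inv i_i (negbT (gtn_eqF (ltnSn i))) (tauE i_i1 i_i (negbT (gtn_eqF (ltnSn i)))).
rewrite /weyl !sl_mulE eU eL scale1r scaleNr scale1r.
have LU : E i.+1 i * E i i.+1 = E i.+1 i.+1 by rewrite E_mul ?eqxx.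
have UL : E i i.+1 * E i.+1 i = E i i by rewrite E_mul ?eqxx.
have UU : E i i.+1 * E i i.+1 = 0 by rewrite E_mul // gtn_eqF.
have PU : E i i * E i i.+1 = E i i.+1 by rewrite E_mul ?eqxx.
have -> : (1 + E i i.+1) * (1 - E i.+1 i) = 1 - E i i - E i.+1 i + E i i.+1.
  by rewrite [LHS]mulrDr mulrN mulr1 [_ * E i.+1 i]mulrDl mul1r UL; apply/matrixP => r c; rewrite !mxE; ring.
rewrite mulrDr mulr1 !(mulrDl _ _ (E i i.+1)) !mulNr mul1r LU UU PU.
by apply/matrixP => r c; rewrite !mxE; ring.
Qed.

(** On the first two coordinates the matrix is a rotation by a right angle. *)
Lemma weyl1_exp4 : (weyl n (a_ n) (b_ n) 1 ^+ 4 = 1)%g.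
Proof.
have W2 : ((weyl n (a_ n) (b_ n) 1 ^+ 2)%g : 'M[int]_n) = 1 - (E 1 1 + E 2 2) *+ 2.
  rewrite expg2 sl_mulE weylE; last lia.
  rewrite !(mulrDl, mulrDr, mulrN, mulNr, mul1r, mulr1) !E_mul /=; try by rewrite /idx; lia.
  by apply/matrixP => r c; rewrite !mxE; ring.
apply: sl_eqP; rewrite -[4%N]/(2 * 2)%N expgnA expg2 sl_mulE W2 sl_oneE.
rewrite !(mulrDl, mulrDr, mulrN, mulNr, mul1r, mulr1, mulr2n) !E_mul /=; try by rewrite /idx; lia.
by apply/matrixP => r c; rewrite !mxE; ring.
Qed.

Lemma E_row p (q : 'I_n) (Q : 'M[int]_n) r c :
  (E p q.+1 * Q) r c = (r.+1 == p)%:R * Q q c.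
Proof.
rewrite mxE (bigD1 q) //= big1 ?addr0 => [|s sq]; first by rewrite !mxE eqxx andbT.
by move: sq; rewrite -(inj_eq val_inj) !mxE eqSS => /negbTE->; rewrite andbF mul0r.
Qed.

(** The partial products are the matrices a_(m+1), extended by the identity: multiplying
    by weyl i on the left puts row i + 1 in place of row i and the negative of row i in
    place of row i + 1. *)
Lemma prod_weylE m : (m < n)%N ->
  forall r c, ((\prod_(i <- rev (iota 1 m)) weyl n (a_ n) (b_ n) i)%g : 'M[int]_n) r c =
  if (r < m)%N then (c == r.+1 :> nat)%:R
  else if r == m :> nat then (-1) ^+ m * (c == 0 :> nat)%:R else (c == r)%:R.
Proof.
elim: m => [|m IH] mn r c.
  rewrite big_nil ltn0 sl_oneE mxE expr0 mul1r [r == c]eq_sym.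
  by case: (eqVneq (r : nat) 0%N) => // r0; rewrite -val_eqE /= r0.
rewrite -[in iota _ _](addn1 m) iotaD rev_cat big_cat -[rev (iota _ 1)]/[:: m.+1] big_seq1 sl_mulE.
rewrite weylE; last lia.
pose p : 'I_n := Ordinal (ltnW mn); pose q : 'I_n := Ordinal mn.
have Rp a Q : (E a m.+1 * Q) r c = (r.+1 == a)%:R * Q p c := E_row a p Q r c.
have Rq a Q : (E a m.+2 * Q) r c = (r.+1 == a)%:R * Q q c := E_row a q Q r c.
rewrite !(mulrDl, mulNr, mul1r).
have NE (X Y : 'M[int]_n) : (X - Y) r c = X r c - Y r c by rewrite !mxE.
have DE (X Y : 'M[int]_n) : (X + Y) r c = X r c + Y r c by rewrite !mxE.
have mm : (m.+1 < m)%N = false by lia.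
have mm' : (m.+1 == m) = false by lia.
have cq : (c == q) = (c == m.+1 :> nat) by rewrite -(inj_eq val_inj).
have cr : (c == r) = (c == r :> nat) by rewrite -(inj_eq val_inj).
rewrite NE DE !NE !Rp !Rq !IH ?(ltnW mn) //= !eqSS ltnn eqxx mm mm' cq cr exprS.
have [rm|rm|->] := ltngtP (r : nat) m.
- by rewrite ltnS (ltnW rm) [(r : nat) == m.+1]ltn_eqF ?(ltn_trans rm) // mulr0n; ring.
- have [|r1|->] := ltngtP (r : nat) m.+1; [lia|rewrite mulr0n; ring|].
  by rewrite ?ltnn mulr0n mulr1n; ring.
by rewrite ltnSn [m == m.+1]ltn_eqF // mulr0n mulr1n; ring.
Qed.

Lemma prod_weyl_a : (\prod_(i <- rev (iota 1 n.-1)) weyl n (a_ n) (b_ n) i)%g = a_ n.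
Proof.
apply/sl_eqP/matrixP => r c; rewrite prod_weylE; last lia.
rewrite [RHS]a_mxE; have := ltn_ord r; have := ltn_ord c.
have -> : (r.+1 == n) = (r == n.-1 :> nat) by lia.
case: (ltngtP (r : nat) n.-1) => [rn|rn|rn] cn rn'; rewrite ?mulr0 ?addr0 //; first lia.
by rewrite [(c : nat) == r.+1](_ : _ = false) ?add0r //; lia.
Qed.

Lemma R_rel_SL u v : R_rel n (a_ n) (b_ n) u v -> u = v.
Proof.
case=> [i j k l ii ij ik il nij nkl nijkl nil njk|i j k ii ij ik nij njk nik||].
- by apply: elementary_commute (tauE ii ij nij) (tauE ik il nkl) _ _ _ _.
- by apply: sl_eqP; rewrite (elementary_commg ii ij ik nij njk nik (tauE _ _ _) (tauE _ _ _)) ?tauE.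
- exact: weyl1_exp4.
by rewrite prod_weyl_a.
Qed.

End MatrixGenerators.

(** * Homomorphisms out of presented groups *)

Section FreeHom.
Local Open Scope quotient_scope.
Variables (X : choiceType) (H : groupType) (h : X -> H).

Definition eval_word (u : word X) : H :=
  \prod_(l <- u) (if l.2 then h l.1 else (h l.1)^-1).

Lemma eval_free_eq u v : free_eq u v -> eval_word u = eval_word v.
Proof.
elim=> // [? ? ? _ -> _ -> //|{}u {}v x e].
rewrite /eval_word !big_cat !big_cons; congr (_ * _).
by case: e; rewrite /= mulgA ?mulgV ?mulVg mul1g.
Qed.

Definition free_hom (g : free_group X) : H := eval_word (repr g).

Lemma free_hom_pi u : free_hom (\pi_(free_group X) u) = eval_word u.
Proof. exact/eval_free_eq/free_repr. Qed.

Lemma free_homM : {morph free_hom : x y / x * y}.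
Proof.
move=> x y; rewrite [LHS](free_hom_pi (repr x ++ repr y)).
by rewrite /eval_word big_cat.
Qed.

Lemma free_hom1 : free_hom 1 = 1.
Proof. by rewrite [LHS](free_hom_pi [::]) /eval_word big_nil. Qed.

HB.instance Definition _ := isMultiplicative.Build (free_group X) H free_hom free_homM.
HB.instance Definition _ :=
  Multiplicative_isUMagmaMorphism.Build (free_group X) H free_hom free_hom1.

Lemma free_hom_gen x : free_hom (free_gen x) = h x.
Proof. by rewrite free_hom_pi /eval_word big_seq1. Qed.

End FreeHom.

(** Induction on a word representing the element. *)
Lemma free_group_ind (X : choiceType) (Q : free_group X -> Prop) : Q 1 ->
  (forall x g, Q g -> Q (free_gen x * g)) ->
  (forall x g, Q g -> Q ((free_gen x)^-1 * g)) -> forall g, Q g.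
Proof.
move=> Q1 Qgen Qinv g; rewrite -[g]reprK; elim: (repr g) => [//|[x e] u IH].
have piM u1 u2 : \pi_(free_group X)%qT (u1 ++ u2) =
    (\pi_(free_group X)%qT u1 * \pi_(free_group X)%qT u2 : free_group X).
  by apply/eqP/free_eqP/free_sym/free_eq_cat; apply: free_repr.
rewrite -cat1s piM; case: e; first exact: Qgen.
suff -> : \pi_(free_group X)%qT [:: (x, false)] = (free_gen x)^-1 by apply: Qinv.
apply/esym/mulg1_eq; rewrite -piM; apply/eqP/free_eqP.
exact: (free_cancel [::] [::] x true).
Qed.

Section PresHom.
Local Open Scope quotient_scope.
Variables (G H : groupType) (rel : G -> G -> Prop).

Definition rq_proj (g : G) : rel_quot rel := \pi_(rel_quot rel) g.

Lemma rq_projM : {morph rq_proj : x y / x * y}.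
Proof. by move=> x y; rewrite -[RHS]/(rq_mul _ _) rq_piM. Qed.

HB.instance Definition _ := isMultiplicative.Build G (rel_quot rel) rq_proj rq_projM.
HB.instance Definition _ :=
  Multiplicative_isUMagmaMorphism.Build G (rel_quot rel) rq_proj (erefl _).

Lemma rq_proj_rel u v : rel u v -> rq_proj u = rq_proj v.
Proof. by move=> uv; apply/eqP/rq_eqP; apply: ncl_relator. Qed.

Lemma rq_proj_surj p : exists g, p = rq_proj g.
Proof. by exists (repr p); rewrite /rq_proj reprK. Qed.

Variable f : UMagmaMorphism.type G H.
Hypothesis f_rel : forall u v, rel u v -> f u = f v.

Lemma normal_closure_ker g : normal_closure rel g -> f g = 1.
Proof.
elim=> [u v /f_rel e||{}g h _ fg _ fh|{}g _ fg|{}g h _ fg].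
- by rewrite gmulfF e mulgV.
- exact: gmulf1.
- by rewrite gmulfM fg fh mulg1.
- by rewrite gmulfV fg invg1.
by rewrite gmulfJ fg conj1g.
Qed.

(** The proof that f respects the relations is an argument, so that the multiplicativity
    can be registered as a structure on the term. *)
Definition pres_hom of (forall u v, rel u v -> f u = f v) := fun p : rel_quot rel => f (repr p).
Local Notation F := (pres_hom f_rel).

Lemma pres_hom_proj g : F (rq_proj g) = f g.
Proof. by apply/divg1_eq; rewrite -gmulfF; apply/normal_closure_ker/rq_repr. Qed.

Lemma pres_homM : {morph F : x y / x * y}.
Proof.
move=> x y; have [g ->] := rq_proj_surj x; have [h ->] := rq_proj_surj y.
by rewrite -rq_projM !pres_hom_proj gmulfM.
Qed.

Lemma pres_hom1 : F 1 = 1.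
Proof. by rewrite [LHS](pres_hom_proj 1) gmulf1. Qed.

HB.instance Definition _ := isMultiplicative.Build (rel_quot rel) H F pres_homM.
HB.instance Definition _ :=
  Multiplicative_isUMagmaMorphism.Build (rel_quot rel) H F pres_hom1.

End PresHom.

Section TauMorph.
Variables (G H : groupType) (f : UMagmaMorphism.type G H) (n : nat) (a b : G).

Lemma tau_sub_morph r : f (tau_sub a b r) = tau_sub (f a) (f b) r.
Proof. by rewrite /tau_sub !gmulfM gmulfV !gmulfXn. Qed.

Lemma tau_1n_morph : f (tau_1n n a b) = tau_1n n (f a) (f b).
Proof. by rewrite /tau_1n; case: (odd n); rewrite ?gmulfV !gmulfM gmulfV !gmulfXn. Qed.

Lemma tau_diag_morph d j : f (tau_diag a b d j) = tau_diag (f a) (f b) d j.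
Proof.
elim: d j => [|d IH] j /=; first exact: tau_sub_morph.
by rewrite gmulfR IH tau_sub_morph.
Qed.

Lemma tau_last_morph i : f (tau_last n a b i) = tau_last n (f a) (f b) i.
Proof.
by rewrite /tau_last; case: (i == 1%N); rewrite ?gmulfR ?tau_1n_morph ?tau_diag_morph.
Qed.

Lemma tau_morph i j : f (tau n a b i j) = tau n (f a) (f b) i j.
Proof.
rewrite /tau; case: ifP => _; first exact: tau_diag_morph.
by case: ifP => _; rewrite ?gmulfR tau_last_morph ?tau_diag_morph.
Qed.

Lemma weyl_morph i : f (weyl n a b i) = weyl n (f a) (f b) i.
Proof. by rewrite /weyl !gmulfM gmulfV !tau_morph. Qed.

Lemma R_rel_morph u v : R_rel n a b u v -> R_rel n (f a) (f b) (f u) (f v).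
Proof.
case=> [i j k l *|i j k *||].
- by rewrite gmulfR gmulf1 !tau_morph; apply: R_comm.
- by rewrite gmulfR !tau_morph; apply: R_steinberg.
- by rewrite gmulfXn gmulf1 weyl_morph; apply: R_weyl4.
by rewrite gmulf_prod; under eq_bigr do rewrite weyl_morph; apply: R_a.
Qed.

(** A relation between images comes from the same relation in the source, because each
    relation is an identity between words in a and b. *)
Lemma R_rel_lift u v : R_rel n (f a) (f b) u v ->
  exists u' v', [/\ R_rel n a b u' v', u = f u' & v = f v'].
Proof.
case=> [i j k l ? ? ? ? ? ? ? ? ?|i j k ? ? ? ? ? ?||].
- exists [~ tau n a b i j, tau n a b k l], 1; rewrite gmulfR gmulf1 !tau_morph.
  by split=> //; apply: R_comm.
- exists [~ tau n a b i j, tau n a b j k], (tau n a b i k); rewrite gmulfR !tau_morph.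
  by split=> //; apply: R_steinberg.
- exists (weyl n a b 1 ^+ 4), 1; rewrite gmulfXn gmulf1 weyl_morph.
  by split=> //; apply: R_weyl4.
exists a, (\prod_(i <- rev (iota 1 n.-1)) weyl n a b i); split=> //; first exact: R_a.
by rewrite gmulf_prod; apply: eq_bigr => i _; rewrite weyl_morph.
Qed.

End TauMorph.

(** The inverse is computed by choice in the source group. *)
Lemma inverse_multiplicative (G H : groupType) (f : UMagmaMorphism.type G H) :
  injective f -> (forall y, exists x, f x = y) ->
  exists2 g : {multiplicative H -> G}, bijective g & cancel f g.
Proof.
move=> f_inj f_surj.
have ex y : exists x, f x == y by have [x <-] := f_surj y; exists x.
pose g y := xchoose (ex y).
have gK : cancel g f by move=> y; apply/eqP/(xchooseP (ex y)).
have fK : cancel f g by move=> x; apply/f_inj/gK.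
have gM : {morph g : x y / x * y} := can2_gmulfM fK gK.
exists (HB.pack_for {multiplicative H -> G} g (isMultiplicative.Build H G g gM)) => //.
by exists f.
Qed.

(** * Infinite order *)

Section PeriodicSequences.
Local Open Scope ring_scope.

Lemma sum_shift (f : nat -> int) k j : (forall m, f (m + k)%N = f m) ->
  \sum_(m < k) f (m + j)%N = \sum_(m < k) f m.
Proof.
move=> fk; elim: j => [|j IH]; first by apply: eq_bigr => m _; rewrite addn0.
rewrite -IH; apply: (addrI (f j)).
have := big_ord_recl k (fun m => f (m + j)%N) : \sum_(m < k.+1) _ = _.
rewrite add0n big_ord_recr /= [(k + j)%N]addnC fk addrC => ->.
by congr (_ + _); apply: eq_bigr => m _; rewrite -addSnnS.
Qed.

(** Write S for the sum of the squares s_m^2 over a period and C1, C2 for the sums of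
    s_(m+1) s_m and s_(m+2) s_m. Squaring the recurrence and its sum over two
    consecutive indices gives 2 C1 = S and 2 C2 = - S, and then the sum of the squares
    of s_(m+2) - s_(m+1) + s_m is 3 S - 4 C1 + 2 C2 = 0. *)
Lemma periodic_recurrence (s : nat -> int) (e : int) n k : e * e = 1 ->
  (forall m, s (m + n).+1 - s (m + n)%N = e * s m) ->
  (0 < k)%N -> (forall m, s (m + k)%N = s m) ->
  forall m, (m < k)%N -> s m.+2 - s m.+1 + s m = 0.
Proof.
move=> ee rec k0 sk.
have per (g : int -> int -> int -> int) j :
    \sum_(m < k) g (s (m + j).+2) (s (m + j).+1) (s (m + j)%N) =
    \sum_(m < k) g (s m.+2) (s m.+1) (s m).
  by apply: (sum_shift (f := fun m => g (s m.+2) (s m.+1) (s m))) => m; rewrite -!addSn !sk.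
pose S := \sum_(m < k) s m * s m.
pose C1 := \sum_(m < k) s m.+1 * s m.
pose C2 := \sum_(m < k) s m.+2 * s m.
have S1 : \sum_(m < k) s m.+1 * s m.+1 = S.
  by rewrite /S -(per (fun _ _ a => a * a) 1%N); apply: eq_bigr => m _; rewrite addn1.
have S2 : \sum_(m < k) s m.+2 * s m.+2 = S.
  by rewrite /S -(per (fun _ _ a => a * a) 2%N); apply: eq_bigr => m _; rewrite addn2.
have C1' : \sum_(m < k) s m.+2 * s m.+1 = C1.
  by rewrite /C1 -(per (fun _ b a => b * a) 1%N); apply: eq_bigr => m _; rewrite addn1.
have E1 : S + S - C1 - C1 = S.
  rewrite -{1}S1 /C1 -big_split -!sumrB /=.
  rewrite (eq_bigr (fun m : 'I_k => (s m.+1 - s m) * (s m.+1 - s m))); last by move=> m _; ring.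
  rewrite -(per (fun _ b a => (b - a) * (b - a)) n) /S.
  by apply: eq_bigr => m _; rewrite rec mulrACA ee mul1r.
have E2 : S + S - C2 - C2 = S + S + C1 + C1.
  rewrite -{1}S2 /C2 -big_split -!sumrB /=.
  rewrite (eq_bigr (fun m : 'I_k => (s m.+2 - s m) * (s m.+2 - s m))); last by move=> m _; ring.
  rewrite -(per (fun c _ a => (c - a) * (c - a)) n).
  rewrite -{1}S1 /S /C1 -!big_split; apply: eq_bigr => m _ /=.
  have -> : s (m + n).+2 - s (m + n)%N = e * (s m.+1 + s m).
    by rewrite mulrDr -!rec addSn; ring.
  by rewrite mulrACA ee; ring.
have sum0 : \sum_(m < k) (s m.+2 - s m.+1 + s m) ^+ 2 = 0.
  pose C1s := \sum_(m < k) s m.+2 * s m.+1.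
  have -> : \sum_(m < k) (s m.+2 - s m.+1 + s m) ^+ 2 =
      \sum_(m < k) s m.+2 * s m.+2 + \sum_(m < k) s m.+1 * s m.+1 + S
      - C1s - C1s - C1 - C1 + C2 + C2.
    rewrite /S /C1s /C1 /C2 -!big_split -!sumrB -!big_split /=.
    by apply: eq_bigr => m _; ring.
  by rewrite S1 S2 /C1s C1'; lia.
move=> m mk; apply/eqP; rewrite -sqrf_eq0; apply/eqP.
exact: (psumr_eq0P (fun (i : 'I_k) _ => sqr_ge0 (s i.+2 - s i.+1 + s i)) sum0 (i := Ordinal mk) isT).
Qed.

End PeriodicSequences.

Section InfiniteOrder.
Local Open Scope ring_scope.
Variable n : nat.
Hypothesis n_gt2 : (2 < n)%N.

Lemma y_infinite_order : infinite_order (y_ n).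
Proof.
have bk k : elementary (b_ n ^+ k)%g k%:Z 2 1.
  elim: k => [|k IH]; first by rewrite /elementary expg0 scale0r addr0.
  rewrite /elementary expgS sl_mulE IH -[slval (b_ n)]/(1 + E n 2 1).
  rewrite mulrDl !mulrDr !mul1r mulr1 scaleAr E_mul /= ?scaler0 ?addr0; last by rewrite /idx; lia.
  by rewrite intS scalerDl scale1r -addrA [_ *: _ + _]addrC.
move=> k k0 yk; have := bk k; rewrite /elementary yk sl_oneE.
pose r : 'I_n := Ordinal (ltnW n_gt2); pose c : 'I_n := Ordinal (ltnW (ltnW n_gt2)).
by move=> /matrixP/(_ r c); rewrite !mxE /=; lia.
Qed.

Lemma x_mxE : (x_ n : 'M[int]_n) = a_mx n + E n 1 1.
Proof.
rewrite sl_mulE /= /b_mx -[1%:M]/(1 : 'M_n) mulrDr mulr1 a_mul_E //; lia.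
Qed.

(** The rows of x_n show that it moves the coordinates 3, ..., n up by one, puts eps_n
    times the first coordinate at the bottom and adds the second coordinate to the first
    one; so the increments of the first coordinate are its earlier values, up to sign.
    *)
Lemma x_infinite_order : infinite_order (x_ n).
Proof.
move=> k k0 xk.
pose z : 'I_n := Ordinal (ltnW (ltnW n_gt2)).
(* Natural numbers as indices, so that coordinates can be shifted. *)
pose v m (r : nat) : int := if insub r is Some i then (x_ n ^+ m)%g i z else 0.
have vE m (r : 'I_n) : v m r = (x_ n ^+ m)%g r z by rewrite /v insubT //= => rn; congr (slval _ _ _); apply: val_inj.
have vS m (r : 'I_n) : v m.+1 r =
   (r == 0 :> nat)%:R * v m 0%N + (if (r.+1 < n)%N then v m r.+1 else (-1) ^+ n.-1 * v m 0%N).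
  rewrite vE expgS sl_mulE x_mxE mulrDl [LHS]mxE addrC -[1%N]/(val z).+1 E_row eqSS -vE.
  congr (_ + _).
  rewrite mxE; case: ltnP => rn.
    pose r1 : 'I_n := Ordinal rn.
    rewrite (bigD1 r1) //= big1 ?addr0 => [|i ir].
      by rewrite a_mxE eqxx /= andbF mulr0 addr0 mul1r -(vE m r1).
    move: ir; rewrite -(inj_eq val_inj) a_mxE /= => /negbTE ->.
    by rewrite ltn_eqF // !mulr0 mul0r.
  rewrite (bigD1 z) //= big1 ?addr0 => [|i iz].
    by rewrite a_mxE /= add0r -(vE m z) andbT (_ : r.+1 == n) ?mulr1 //; have := ltn_ord r; lia.
  move: iz; rewrite -(inj_eq val_inj) a_mxE /= => /negbTE ->.
  by rewrite andbF mulr0 addr0 ltn_eqF ?mul0r // (leq_trans (ltn_ord i)).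
pose s m := v m 0%N.
have s_step m : s m.+1 - s m = v m 1%N.
  by rewrite /s (vS m z) (ltnW n_gt2) /=; lia.
have v_step m r : (0 < r)%N -> (r.+1 < n)%N -> v m.+1 r = v m r.+1.
  by move=> r0 rn; rewrite (vS m (Ordinal (ltnW rn))) /= rn gtn_eqF // mul0r add0r.
have v_steps j m : (j.+1 < n)%N -> v (m + j)%N 1%N = v m j.+1.
  elim: j m => [|j IH] m jn; first by rewrite addn0.
  by rewrite -addSnnS IH ?(ltnW jn) // v_step.
have rec m : s (m + n.-1).+1 - s (m + n.-1)%N = (-1) ^+ n.-1 * s m.
  rewrite s_step (_ : (m + n.-1 = m.+1 + n.-2)%N); last lia.
  rewrite v_steps; last lia.
  have n1 : (n.-2.+1 < n)%N by lia.
  rewrite (vS m (Ordinal n1)) /= ifF; last lia.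
  by rewrite mul0r add0r.
have sk m : s (m + k)%N = s m by rewrite /s /v expgnDr xk mulg1.
have v0 r : (0 < r)%N -> v 0%N r = 0.
  rewrite /v; case: insubP => // i _ <- i0.
  by rewrite expg0 sl_oneE mxE -(inj_eq val_inj) /= gtn_eqF.
have s0 : s 0%N = 1 by rewrite /s (vE 0%N z) expg0 sl_oneE mxE eqxx.
have s1 : s 1%N = 1 by have := s_step 0%N; rewrite (v0 1%N) // s0; lia.
have s2 : s 2%N = 1 by have := s_step 1%N; rewrite (v_step 0%N 1%N) // v0 // s1; lia.
have ee : (-1) ^+ n.-1 * (-1) ^+ n.-1 = 1 :> int by rewrite -expr2 sqrr_sign.
by have := periodic_recurrence ee rec k0 sk k0; rewrite s0 s1 s2.
Qed.

End InfiniteOrder.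

(** * The presentation *)

(** For any elements a, b of a group that satisfy the relations R_n; applied below to
    the presented group itself. *)
Section Presentation.
Variables (n : nat) (G : groupType) (a b : G).
Hypothesis n_gt2 : (2 < n)%N.
Hypothesis rels : forall u v, R_rel n a b u v -> u = v.

Definition tau_ord (i j : 'I_n) : G := tau n a b i.+1 j.+1.

Lemma tau_ordC i j k l : i != j -> k != l -> i != l -> j != k -> commute (tau_ord i j) (tau_ord k l).
Proof.
move=> ij kl il jk.
have [[-> ->]|ijkl] := eqVneq (i, j) (k, l); first exact: commute_refl.
by apply/commgP/eqP/rels/R_comm; rewrite /idx ?ltn_ord.
Qed.

Lemma tau_ordS i j k : i != j -> j != k -> i != k -> [~ tau_ord i j, tau_ord j k] = tau_ord i k.
Proof. by move=> ij jk ik; apply/rels/R_steinberg; rewrite /idx ?ltn_ord. Qed.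

Lemma weyl_tau_ord (i j : 'I_n) : j = i.+1 :> nat -> weyl n a b i.+1 = w tau_ord i j false.
Proof. by move=> ji; rewrite /w /te /tau_ord /= ji. Qed.

Lemma tau_ord_w4 : exists i j, i != j /\ w tau_ord i j false ^+ 4 = 1.
Proof.
exists (Ordinal (ltnW (ltnW n_gt2))), (Ordinal (ltnW n_gt2)); split=> //.
by rewrite -weyl_tau_ord //; apply/rels/R_weyl4.
Qed.

Lemma full_te (i j : 'I_n) e : i != j -> full tau_ord [set: 'I_n] (te tau_ord i j e).
Proof. by move=> ij; apply: gen_in; exists i, j, e; rewrite /= !inE. Qed.

Lemma full_b : full tau_ord [set: 'I_n] b.
Proof.
have -> : b = te tau_ord (Ordinal (ltnW n_gt2)) (Ordinal (ltnW (ltnW n_gt2))) false.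
  by rewrite /te /tau_ord /tau /tau_low /= /tau_sub expg0 invg1 mul1g mulg1.
exact: full_te.
Qed.

(** By the last of the relations, a is a product of the tau_ij and their inverses. *)
Lemma full_a : full tau_ord [set: 'I_n] a.
Proof.
have -> : a = \prod_(i <- rev (iota 1 n.-1)) weyl n a b i by apply/rels/R_a.
have : {in rev (iota 1 n.-1), forall i, full tau_ord [set: 'I_n] (weyl n a b i)}.
  move=> i; rewrite mem_rev mem_iota => /andP[i0 i_n].
  have lt1 : (i.-1 < n)%N by lia.
  have lt2 : (i < n)%N by lia.
  have ne : Ordinal lt1 != Ordinal lt2 by rewrite -(inj_eq val_inj) /=; lia.
  rewrite (_ : weyl n a b i = w tau_ord (Ordinal lt1) (Ordinal lt2) false); last first.
    by rewrite -weyl_tau_ord /= prednK.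
  by rewrite /w; do !apply: gen_mul; apply: full_te; rewrite // eq_sym.
elim: (rev _) => [|i s IH] in_s; first by rewrite big_nil; apply: gen1.
rewrite big_cons; apply: gen_mul; first by apply: in_s; rewrite mem_head.
by apply: IH => k ks; apply: in_s; rewrite inE ks orbT.
Qed.

Variable phi : UMagmaMorphism.type G (SL int n).
Hypotheses (phi_a : phi a = a_ n) (phi_b : phi b = b_ n).
Hypothesis ab_gen : forall x, full tau_ord [set: 'I_n] x.

Lemma phi_tau_ord (i j : 'I_n) : i != j ->
  (phi (tau_ord i j) : 'M[int]_n) = (1%:M + delta_mx i j)%R.
Proof.
move=> ij; rewrite /tau_ord tau_morph phi_a phi_b.
rewrite (tauE n_gt2) /idx ?ltn_ord // scale1r; congr (_ + _)%R.
by apply/matrixP => r c; rewrite !mxE !eqSS.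
Qed.

(** The theorem on Steinberg relations, applied to the tau_ij. *)
Lemma presentation_bij : injective phi /\ forall M, exists x, phi x = M.
Proof.
split; last first.
  move=> M; apply: (phi_surj_full n_gt2 tau_ordC tau_ordS phi_tau_ord (A := [set: 'I_n])).
  by move=> i j; rewrite !inE.
apply: gmulf_inj => x.
exact: (phi_inj_full n_gt2 tau_ordC tau_ordS tau_ord_w4 phi_tau_ord (ab_gen x)).
Qed.

End Presentation.

Theorem proposition4p1 (n : nat) (hn : (3 <= n)%N) :
  [/\ infinite_order (x_ n),
      infinite_order (y_ n),
      a_ n = x_ n * (y_ n)^-1,
      b_ n = y_ n
    & exists f : {multiplicative SL int n -> Pres n},
        [/\ bijective f, f (x_ n) = px n & f (y_ n) = py n]].
Proof.
have ab : a_ n = x_ n * (y_ n)^-1 by rewrite /x_ /y_ mulgK.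
split=> //; [exact: x_infinite_order|exact: y_infinite_order|].
pose f0 : UMagmaMorphism.type Fxy (SL int n) := free_hom (fun c : bool => if c then x_ n else y_ n).
have f0x : f0 gx = x_ n by apply: free_hom_gen.
have f0y : f0 gy = y_ n by apply: free_hom_gen.
have f0_rel u v : R_rel n (gx / gy) gy u v -> f0 u = f0 v.
  move=> /(R_rel_morph f0); rewrite gmulfF f0x f0y -ab; exact: R_rel_SL.
pose phi : UMagmaMorphism.type (Pres n) (SL int n) := pres_hom f0_rel.
have phix : phi (px n) = x_ n by rewrite -f0x; apply: (pres_hom_proj f0_rel).
have phiy : phi (py n) = y_ n by rewrite -f0y; apply: (pres_hom_proj f0_rel).
pose proj : UMagmaMorphism.type Fxy (Pres n) := @rq_proj _ (R_rel n (gx / gy) gy).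
pose a := px n / py n; pose b := py n.
have proj_a : proj (gx / gy) = a by rewrite gmulfF.
have rels u v : R_rel n a b u v -> u = v.
  rewrite -proj_a => /(R_rel_lift (f := proj))[u' [v' [uv -> ->]]].
  exact: rq_proj_rel.
have gen_tau_ord x : full (tau_ord a b) [set: 'I_n] x.
  have [Fa Fb] := (full_a hn rels, @full_b n _ a b hn).
  have Fx : full (tau_ord a b) [set: 'I_n] (px n).
    by rewrite -[px n](mulgVK b); apply: gen_mul.
  have [g ->] := rq_proj_surj x; elim/free_group_ind: g => [|c g IH|c g IH].
  - exact: gen1.
  - by rewrite rq_projM; apply: gen_mul => //; case: c.
  rewrite rq_projM (gmulfV proj); apply: gen_mul => //; apply: fullV.
  by case: c.
have phi_a : phi a = a_ n by rewrite gmulfF phix phiy.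
have phi_b : phi b = b_ n by rewrite phiy.
have [phi_inj phi_surj] := presentation_bij hn rels phi_a phi_b gen_tau_ord.
have [f f_bij fK] := inverse_multiplicative phi_inj phi_surj.
by exists f; split; rewrite // -1?phix -1?phiy fK.
Qed.
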